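(* Let $t_0 = \frac{4}{3}\left(\frac{4}{\sqrt{3}}+1\right)^3$ and fix $t \ge 2t_0+2$. For every packing $\mathscr{Z}$ of $\mathbb{R}^3$ by $t$-cylinders, the upper density satisfies $$\rho^+(\mathscr{Z}) \le \frac{t}{\frac{\sqrt{12}}{\pi}(t-2-2t_0) + 2t_0+\frac{4}{3}}.$$
   Context: A $t$-cylinder is a closed solid circular cylinder in $\mathbb{R}^3$ of unit radius and length $t$. A packing of $\mathbb{R}^3$ by $t$-cylinders is a countable family $\mathscr{Z}=\{Z_i\}_{i\in I}$ of $t$-cylinders in $\mathbb{R}^3$ with mutually disjoint interiors. $B(R)$ is the closed ball of radius $R$ centered at $0$. The upper density is $$\rho^+(\mathscr{Z})=\limsup_{R\to\infty}\ \sum_{i\in I:\, Z_i\subseteq B(R)}\frac{\mathrm{Vol}(Z_i)}{\mathrm{Vol}(B(R))}.$$ *)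

(* Defs.v *)
(* MathComp-Analysis. *)
From HB Require Import structures.
From mathcomp Require Import all_boot all_order all_algebra.
From mathcomp Require Import all_classical all_reals all_analysis.

Set Implicit Arguments.
Unset Strict Implicit.
Unset Printing Implicit Defensive.
Import Order.TTheory GRing.Theory Num.Theory.
Import numFieldNormedType.Exports.
Local Open Scope classical_set_scope.
Local Open Scope ring_scope.

(* R^3 is R * R * R, with the product topology and the product of the Lebesgue
   measures.  The library norm of R * R * R is the sup norm (same topology as
   the Euclidean norm), hence the separate Euclidean norm [norm3]. *)
Notation space3 R := (R * R * R)%type.

Definition dot3 (R : realType) (x y : space3 R) : R :=
  x.1.1 * y.1.1 + x.1.2 * y.1.2 + x.2 * y.2.

Definition norm3 (R : realType) (x : space3 R) : R := Num.sqrt (dot3 x x).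

Definition cball3 (R : realType) (r : R) : set (space3 R) :=
  [set x | norm3 x <= r].

Definition vol3 (R : realType) (A : set (space3 R)) : \bar R :=
  ((@lebesgue_measure R \x @lebesgue_measure R) \x @lebesgue_measure R)%E A.

(* [p] is the center of one base and [u] the unit direction of the axis. *)
Definition cylinder3 (R : realType) (t : R) (p u : space3 R) :
    set (space3 R) :=
  [set x | exists (s : R) (w : space3 R),
     [/\ 0 <= s <= t, dot3 w u = 0, norm3 w <= 1 & x = p + s *: u + w]].

Definition is_cylinder (R : realType) (t : R) (A : set (space3 R)) : Prop :=
  exists p u : space3 R, norm3 u = 1 /\ A = cylinder3 t p u.

Definition cylinder_packing (R : realType) (t : R) (I : countType)
    (Z : I -> set (space3 R)) : Prop :=
  (forall i, is_cylinder t (Z i)) /\ trivIset setT (fun i => (Z i)°).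

Definition upper_density (R : realType) (I : countType)
    (Z : I -> set (space3 R)) : \bar R :=
  limf_esup (fun r : R =>
    \esum_(i in [set i | Z i `<=` cball3 r]) (vol3 (Z i) / vol3 (cball3 r))%E)
    +oo%R.

(* Main.v *)
Require Import Defs.
From HB Require Import structures.
From mathcomp Require Import all_boot all_order all_algebra.
From mathcomp Require Import all_classical all_reals all_analysis.
From mathcomp Require Import measurable_realfun ring lra.
Import Order.TTheory GRing.Theory Num.Theory.
Import numFieldNormedType.Exports.
Local Open Scope classical_set_scope.
Local Open Scope ring_scope.
Set Implicit Arguments.
Unset Strict Implicit.
Unset Printing Implicit Defensive.

(** The proof follows A. Bezdek, W. Kuperberg and W. Kusner: each cylinder gets a
    private region of large volume.

    Cut a unit length off both ends of the axis of every cylinder.  Unit balls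
    centered on the remaining inner axis, a segment of length tau = t - 2, still
    lie in the cylinder, so that two inner axes are at distance at least 2
    ([inner_axes_far]).  The [cell] of an inner axis consists of the points at
    distance less than [rho] = 2 / sqrt 3 from it that are strictly closer to it
    than to every other one.  Cells are disjoint, and the cells of cylinders that
    lie in the ball of radius r lie in the ball of radius r + 2; a lower bound V0
    for the average volume of a cell therefore bounds the number of cylinders in
    a ball ([packing_count]), and the density is at most pi t / V0.

    Beyond the ends of its axis a cell contains two unit half-balls, of total
    volume 4 pi / 3.  The rest is integrated over the sections perpendicular to
    the axis ([cell_volume]).  Such a section always contains the unit disc.
    Unless an end of some inner axis is at distance less than 2 rho, its area is
    at least 2 sqrt 3, the area of the regular hexagon circumscribed about the
    unit circle ([qualified_slice]).  Exceptional sections are rare: for a fixed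
    end, unit tubes around the axis points concerned are disjoint and lie in a
    ball of radius 1 + 2 rho, which bounds the total length of these points by
    t0 ([sum_near_point]), and n axes have 2 n ends.  Hence
    V0 = 2 sqrt 3 (tau - 2 t0) + 2 pi t0 + 4 pi / 3.

    The hexagon bound is the heart of the proof.  Near a section without ends
    the other axes are full lines.  The points of the plane that are as close to
    a line as to the center are cut off by a parabola ([cutoff]).  A point of the
    circle of radius rho cannot be in two of these regions, because three points
    with mutual distances at least 2 do not fit into a ball of radius less than
    rho ([sectors_disjoint]).  It is therefore enough that every region occupies
    at most the fraction [kappa] of the sector that it subtends
    ([conic_sector]), where 1 - kappa is the quotient of the area of the hexagon
    by that of the disc of radius rho.  Let th be the half-angle of the sector;
    it is less than pi / 4.  If th <= pi / 6, the triangle spanned by the center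
    and the ends of the arc is left over, and its area suffices
    ([triangle_bound]).  If th is larger, the chord enters the unit disc, the
    parabola does not, and one gains the parabolic segment above the chord,
    two thirds of its base times its height ([parabola_bound]).

    The volumes are computed in an orthonormal frame adapted to the axis.
    Rotations preserve Lebesgue measure because a plane rotation is a product of
    three shears ([preserves_rotation]), and a shear preserves the measure of
    every section along its direction. *)



(** * Lebesgue measure on the line, the plane and space *)
Notation length R := (@lebesgue_measure R).

(** A constant of its own, to which the sigma-finiteness needed for forming the
    product with a third factor can be attached. *)
Definition area (R : realType) : set (measurableTypeR R * measurableTypeR R) -> \bar R :=
  (length R \x length R)%E.

Arguments area : clear implicits.

HB.instance Definition _ (R : realType) := Measure.on (area R).

Lemma area_sigma_finite (R : realType) : sigma_finite setT (area R).
Proof.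
have /sigma_finiteP[F [TF ndF Foo]] := sigma_finiteT (length R).
exists (fun n => F n `*` F n).
  rewrite -setXTT {1}TF {1}TF predeqE => -[x y]; split.
    move=> [/= [n _ Fnx] [k _ Gky]]; exists (maxn n k) => //; split.
    - by move: x Fnx; exact/subsetPset/ndF/leq_maxl.
    - by move: y Gky; exact/subsetPset/ndF/leq_maxr.
  by move=> [n _ []/= ? ?]; split; exists n.
move=> k; have [? ?] := Foo k.
split; first exact: measurableX.
by rewrite /area product_measure1E// lte_mul_pinfty// ge0_fin_numE.
Qed.

HB.instance Definition _ (R : realType) :=
  Measure_isSigmaFinite.Build _ _ _ (area R) (area_sigma_finite R).

Notation volume R := (area R \x length R)%E.

Lemma measurable_preimage d d' (T : measurableType d) (T' : measurableType d')
    (f : T -> T') (A : set T') :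
  measurable_fun setT f -> measurable A -> measurable (f @^-1` A).
Proof. by move=> mf mA; rewrite -[X in measurable X]setTI; exact: mf. Qed.

Section invariance.
Context {R : realType}.

Lemma length_translate (c : R) (A : set R) : measurable A ->
  length R ((fun x => x + c) @^-1` A) = length R A.
Proof.
move=> mA.
pose f := (fun x : R => x + c : measurableTypeR R).
have mf : measurable_fun setT f.
  exact: measurable_funD.
transitivity (pushforward (length R) f A) => //.
apply/esym/lebesgue_measure_unique => //= _ [[a b]] _ <-.
rewrite /pushforward.
have -> : f @^-1` `]a, b] = `]a - c, b - c]%classic.
  by apply/seteqP; split => x /=; rewrite !in_itv/= /f ltrBlDr lerBrDr.
by rewrite !lebesgue_measure_itv/= !lte_fin ltrD2r -!EFinB opprB addrA subrK.
Qed.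

Lemma area_translate (c : R * R) (A : set (R * R)) :
  measurable A -> area R ((fun x => x + c) @^-1` A) = area R A.
Proof.
move=> mA.
pose f (x : R * R) := (x.1 + c.1, x.2 + c.2) : measurableTypeR R * measurableTypeR R.
have mf : measurable_fun setT f.
  by apply: measurable_fun_pair; apply: measurable_funD.
transitivity (pushforward (area R) f A) => //.
apply/esym; rewrite /area; apply: product_measure_unique => //= B C mB mC.
rewrite /pushforward.
transitivity (area R (((fun x => x + c.1) @^-1` B) `*` ((fun x => x + c.2) @^-1` C))) => //.
have mD (e : R) (D : set R) : measurable D -> measurable ((fun x => x + e) @^-1` D).
  by apply: measurable_preimage; exact: measurable_funD.
rewrite /area product_measure1E; [|exact: mD|exact: mD].
by congr (_ * _)%E; apply: length_translate.
Qed.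
End invariance.


(** * Shears, rotations and orthonormal frames *)
Section shear.
Context d1 d2 (T1 : measurableType d1) (T2 : measurableType d2) (R : realType).
Variable m1 : {sigma_finite_measure set T1 -> \bar R}.
Variable m2 : {sigma_finite_measure set T2 -> \bar R}.

Lemma product_measureC (A : set (T1 * T2)) :
  measurable A -> (m1 \x m2)%E A = (m1 \x^ m2)%E A.
Proof.
by move=> mA; apply: product_measure_unique => // *; rewrite /= product_measure2E.
Qed.

(** The sections over the first factor are moved by measure-preserving maps of
    the second one. *)
Lemma shear_snd (g : T1 -> T2 -> T2) (A : set (T1 * T2)) :
  (forall x B, measurable B -> m2 (g x @^-1` B) = m2 B) ->
  measurable A ->
  (m1 \x m2)%E [set p | A (p.1, g p.1 p.2)] = (m1 \x m2)%E A.
Proof.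
move=> gP mA; apply: eq_integral => x _ /=.
rewrite -[RHS](gP x); last exact: measurable_xsection.
by congr (m2 _); apply/seteqP; split => y; rewrite /xsection /= !inE.
Qed.

Lemma shear_fst (g : T2 -> T1 -> T1) (A : set (T1 * T2)) :
  measurable_fun setT (fun p : T1 * T2 => (g p.2 p.1, p.2)) ->
  (forall x B, measurable B -> m1 (g x @^-1` B) = m1 B) ->
  measurable A ->
  (m1 \x m2)%E [set p | A (g p.2 p.1, p.2)] = (m1 \x m2)%E A.
Proof.
move=> mg gP mA; rewrite !product_measureC//; last first.
  exact: (measurable_preimage mg).
apply: eq_integral => x _ /=.
rewrite -[RHS](gP x); last exact: measurable_ysection.
by congr (m1 _); apply/seteqP; split => y; rewrite /ysection /= !inE.
Qed.
End shear.

(** Measurability of maps with polynomial coordinates. *)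
Ltac mfun := repeat first
  [ exact: measurable_cst | exact: measurable_id | exact: measurable_fst
  | exact: measurable_snd
  | exact: measurableT_comp
  | apply: measurable_fun_pair | apply: measurable_funD | apply: measurable_funM
  | apply: measurable_funN | apply: measurable_funX].


Definition preserves d (T : measurableType d) (R : realType)
    (mu : {measure set T -> \bar R}) (f : T -> T) :=
  measurable_fun setT f /\ forall A, measurable A -> mu (f @^-1` A) = mu A.

Lemma preserves_comp d (T : measurableType d) (R : realType)
    (mu : {measure set T -> \bar R}) (f g : T -> T) :
  preserves mu f -> preserves mu g -> preserves mu (f \o g).
Proof.
move=> [mf f_] [mg g_]; split; first exact: measurableT_comp.
move=> A mA; rewrite comp_preimage g_ ?f_//; exact: measurable_preimage.
Qed.

(** The rotation with cosine c and sine s is a product of three shears unless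
    s = 0; the half-turn is the square of a quarter-turn. *)
Lemma preserves_rotation d (T : measurableType d) (R : realType)
    (mu : {measure set T -> \bar R}) (S S' : R -> T -> T) (rot : R -> R -> T -> T) :
  (forall k, preserves mu (S k)) -> (forall k, preserves mu (S' k)) ->
  (forall c s, s != 0 -> c ^+ 2 + s ^+ 2 = 1 ->
    rot c s = S ((c - 1) / s) \o (S' s \o S ((c - 1) / s))) ->
  rot 1 0 = id -> rot (- 1) 0 = rot 0 1 \o rot 0 1 ->
  forall c s, c ^+ 2 + s ^+ 2 = 1 -> preserves mu (rot c s).
Proof.
move=> pS pS' rotE rot1 rotN1.
have rots c s : s != 0 -> c ^+ 2 + s ^+ 2 = 1 -> preserves mu (rot c s).
  move=> s0 cs; rewrite rotE//.
  by apply: preserves_comp => //; exact: preserves_comp.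
move=> c s; have [->|s0] := eqVneq s 0; last exact: rots.
rewrite expr0n/= addr0 => /eqP; rewrite sqrf_eq1 => /orP[/eqP->|/eqP->].
  by rewrite rot1; split; first exact: measurable_id.
by rewrite rotN1; apply: preserves_comp; apply: rots; rewrite ?oner_eq0//
   expr0n expr1n add0r.
Qed.

Section rotations.
Context {R : realType}.
Implicit Types (c s k : R).

Lemma area_shear_fst k : preserves (area R) (fun p => (p.1 + k * p.2, p.2)).
Proof.
split=> [|A mA]; first by mfun.
apply: (@shear_fst _ _ _ _ _ (length R) (length R) (fun y x => x + k * y)) => //.
- mfun.
- by move=> y B mB; apply: length_translate.
Qed.

Lemma area_shear_snd k : preserves (area R) (fun p => (p.1, p.2 + k * p.1)).
Proof.
split=> [|A mA]; first by mfun.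
apply: (@shear_snd _ _ _ _ _ (length R) (length R) (fun x y => y + k * x)) => //.
by move=> y B mB; apply: length_translate.
Qed.

Definition rot2 c s (p : R * R) : R * R := (c * p.1 - s * p.2, s * p.1 + c * p.2).

Lemma area_rot2 c s : c ^+ 2 + s ^+ 2 = 1 -> preserves (area R) (rot2 c s).
Proof.
apply: (preserves_rotation area_shear_fst area_shear_snd).
- move=> {}c {}s s0 cs; apply/funext => -[x y]; rewrite /rot2/=.
  have e : c ^+ 2 = 1 - s ^+ 2 by rewrite -cs addrK.
  congr (_, _); field: e; exact: s0.
- by apply/funext => -[x y]; rewrite /rot2/=; congr (_, _); ring.
- by apply/funext => -[x y]; rewrite /rot2/=; congr (_, _); ring.
Qed.

Lemma volume_shear13 k : preserves (volume R) (fun p => ((p.1.1 + k * p.2, p.1.2), p.2)).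
Proof.
split=> [|A mA]; first by mfun.
apply: (@shear_fst _ _ _ _ _ (area R) (length R) (fun z p => (p.1 + k * z, p.2))) => //.
- mfun.
- move=> z B mB; rewrite -[RHS](area_translate (k * z, 0) mB); congr (area R _).
  by apply/funext => -[x y] /=; congr (B (_, _)); rewrite /= addr0.
Qed.

Lemma volume_shear23 k : preserves (volume R) (fun p => ((p.1.1, p.1.2 + k * p.2), p.2)).
Proof.
split=> [|A mA]; first by mfun.
apply: (@shear_fst _ _ _ _ _ (area R) (length R) (fun z p => (p.1, p.2 + k * z))) => //.
- mfun.
- move=> z B mB; rewrite -[RHS](area_translate (0, k * z) mB); congr (area R _).
  by apply/funext => -[x y] /=; congr (B (_, _)); rewrite /= addr0.
Qed.

Lemma volume_shear31 k : preserves (volume R) (fun p => (p.1, p.2 + k * p.1.1)).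
Proof.
split=> [|A mA]; first by mfun.
apply: (@shear_snd _ _ _ _ _ (area R) (length R) (fun p z => z + k * p.1)) => //.
by move=> y B mB; apply: length_translate.
Qed.

Lemma volume_shear32 k : preserves (volume R) (fun p => (p.1, p.2 + k * p.1.2)).
Proof.
split=> [|A mA]; first by mfun.
apply: (@shear_snd _ _ _ _ _ (area R) (length R) (fun p z => z + k * p.2)) => //.
by move=> y B mB; apply: length_translate.
Qed.

Lemma volume_translate (a : space3 R) : preserves (volume R) (fun p => p + a).
Proof.
have -> : (fun p => p + a) = (fun p : space3 R => (p.1, p.2 + a.2)) \o
  (fun p => (p.1 + a.1, p.2)) by apply/funext => -[[x y] z].
apply: preserves_comp; split=> [|B mB].
- mfun.
- apply: (@shear_snd _ _ _ _ _ (area R) (length R) (fun p z => z + a.2)) => //.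
  by move=> y C mC; apply: length_translate.
- suff : measurable_fun setT (fun p : space3 R => ((p.1.1 + a.1.1, p.1.2 + a.1.2), p.2)) by [].
  mfun.
- apply: (@shear_fst _ _ _ _ _ (area R) (length R) (fun z p => p + a.1)) => //.
    suff : measurable_fun setT (fun p : space3 R => ((p.1.1 + a.1.1, p.1.2 + a.1.2), p.2)) by [].
    mfun.
  by move=> z C mC; apply: area_translate.
Qed.

Definition rot13 c s (p : space3 R) : space3 R :=
  ((c * p.1.1 - s * p.2, p.1.2), s * p.1.1 + c * p.2).
Definition rot23 c s (p : space3 R) : space3 R :=
  ((p.1.1, c * p.1.2 - s * p.2), s * p.1.2 + c * p.2).

Lemma volume_rot13 c s : c ^+ 2 + s ^+ 2 = 1 -> preserves (volume R) (rot13 c s).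
Proof.
apply: (preserves_rotation volume_shear13 volume_shear31).
- move=> {}c {}s s0 cs; apply/funext => -[[x y] z]; rewrite /rot13/=.
  have e : c ^+ 2 = 1 - s ^+ 2 by rewrite -cs addrK.
  congr (_, _, _); field: e; exact: s0.
- by apply/funext => -[[x y] z]; rewrite /rot13/=; congr (_, _, _); ring.
- by apply/funext => -[[x y] z]; rewrite /rot13/=; congr (_, _, _); ring.
Qed.

Lemma volume_rot23 c s : c ^+ 2 + s ^+ 2 = 1 -> preserves (volume R) (rot23 c s).
Proof.
apply: (preserves_rotation volume_shear23 volume_shear32).
- move=> {}c {}s s0 cs; apply/funext => -[[x y] z]; rewrite /rot23/=.
  have e : c ^+ 2 = 1 - s ^+ 2 by rewrite -cs addrK.
  congr (_, _, _); field: e; exact: s0.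
- by apply/funext => -[[x y] z]; rewrite /rot23/=; congr (_, _, _); ring.
- by apply/funext => -[[x y] z]; rewrite /rot23/=; congr (_, _, _); ring.
Qed.

(** A rotation in the plane 2-3 brings u into the plane 1-3, and a rotation there
    brings it to the third axis. *)
Lemma exists_frame (u : space3 R) : dot3 u u = 1 ->
  exists L : space3 R -> space3 R, [/\ preserves (volume R) L,
    forall p q, L (p - q) = L p - L q,
    forall k p, L (k *: p) = k *: L p,
    forall p q, dot3 (L p) (L q) = dot3 p q & L u = (0, 0, 1)].
Proof.
case: u => [[a b] z]; rewrite /dot3/= => u1.
pose r := Num.sqrt (b * b + z * z).
have r2 : r * r = b * b + z * z by rewrite -expr2 sqr_sqrtr ?addr_ge0 // -expr2 sqr_ge0.
have [r0|r0] := eqVneq r 0.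
  move: r2; rewrite r0 mul0r => /esym bz.
  have b0 : b = 0 by nra.
  have z0 : z = 0 by nra.
  have aa : 0 ^+ 2 + a ^+ 2 = 1 by move: u1; rewrite b0 z0; lra.
  exists (rot13 0 a); split; first exact: volume_rot13.
  - by move=> [[x y] w] [[x' y'] w']; rewrite /rot13/=; congr (_, _, _) => /=; ring.
  - by move=> k [[x y] w]; rewrite /rot13/=; congr (_, _, _) => /=; rewrite /GRing.scale/=; ring.
  - move=> [[x y] w] [[x' y'] w']; rewrite /rot13/dot3/=.
    transitivity (x * x' * a ^+ 2 + y * y' + w * w' * a ^+ 2); first by ring.
    by move: aa; rewrite expr0n add0r => ->; ring.
  - by rewrite /rot13/= b0 z0; congr (_, _, _); rewrite ?mul0r ?mulr0 ?subr0 ?addr0// -expr2; lra.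
have cs : (z / r) ^+ 2 + (b / r) ^+ 2 = 1.
  by rewrite !exprMn -mulrDl !exprVn addrC !expr2 -r2 divff// mulf_neq0.
have ar : r ^+ 2 + a ^+ 2 = 1 by rewrite !expr2 r2 -u1; ring.
have [p23 p13] := (volume_rot23 cs, volume_rot13 ar).
exists (rot13 r a \o rot23 (z / r) (b / r)); split; first exact: preserves_comp.
- by move=> [[x y] w] [[x' y'] w']; rewrite /rot13/=; congr (_, _, _) => /=; ring.
- by move=> k [[x y] w]; rewrite /rot13/=; congr (_, _, _) => /=; rewrite /GRing.scale/=; ring.
- move=> [[x y] w] [[x' y'] w']; rewrite /rot13/rot23/dot3/=.
  set C := z / r in cs *; set S := b / r in cs *.
  transitivity (x * x' * (r ^+ 2 + a ^+ 2) + y * y' * C ^+ 2 + S ^+ 2 * w * w'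
     - C * S * (y * w' + w * y') + (r ^+ 2 + a ^+ 2) * (S * y + C * w) * (S * y' + C * w')).
    by ring.
  rewrite ar; transitivity (x * x' + (C ^+ 2 + S ^+ 2) * (y * y' + w * w')); first by ring.
  by rewrite cs; ring.
- rewrite /rot13/rot23/=.
  have -> : b / r * b + z / r * z = r.
    by transitivity ((b * b + z * z) / r); [ring|rewrite -r2 mulfK].
  congr (_, _, _); [ring| |by rewrite -ar; ring].
  by field.
Qed.

End rotations.


(** * One-dimensional integrals *)
Section calculus.
Context {R : realType}.
Implicit Types (f F G : R -> R) (a b r l h : R).

Lemma is_derive_continuous F f :
  (forall x : R, is_derive x 1 F (f x)) -> continuous F.
Proof.
move=> dF x.
by apply: differentiable_continuous; apply/derivable1_diffP; have [] := dF x.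
Qed.

Lemma is_derive_oo_LRcontinuous F f a b :
  (forall x : R, is_derive x 1 F (f x)) -> derivable_oo_LRcontinuous F a b.
Proof.
move=> dF.
have cF := is_derive_continuous dF.
split; [by move=> x _; have [] := dF x| |].
- by apply: cvg_at_right_filter; exact: cF.
- by apply: cvg_at_left_filter; exact: cF.
Qed.

Lemma FTC2_smooth F f a b : a <= b ->
  (forall x : R, is_derive x 1 F (f x)) -> continuous f ->
  (\int[length R]_(x in `[a, b]) (f x)%:E = (F b - F a)%:E)%E.
Proof.
rewrite le_eqVlt => /predU1P[<- _ _|ab dF cf].
  by rewrite set_itv1 integral_set1 subrr.
rewrite EFinB; apply: continuous_FTC2 => //.
- exact: continuous_subspaceT.
- exact: is_derive_oo_LRcontinuous dF.
- by move=> x _; rewrite derive1E; have [_ ->] := dF x.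
Qed.

Lemma substitution_smooth F f G a b : a <= b ->
  {in `[a, b] &, {homo F : x y /~ (x < y)%R}} ->
  (forall x : R, is_derive x 1 F (f x)) -> continuous f -> continuous G ->
  (\int[length R]_(x in `[F b, F a]) (G x)%:E =
   \int[length R]_(x in `[a, b]) (G (F x) * - f x)%:E)%E.
Proof.
move=> ab dec dF cf cG.
have F'E : F^`()%classic = f.
  by apply/funext => x; rewrite derive1E; have [_ ->] := dF x.
rewrite integration_by_substitution_decreasing ?F'E//.
- apply/cvg_ex; exists (f a); apply: cvg_at_right_filter; exact: cf.
- apply/cvg_ex; exists (f b); apply: cvg_at_left_filter; exact: cf.
- exact: is_derive_oo_LRcontinuous dF.
- exact: continuous_subspaceT.
Qed.

Lemma continuous_semichord r :
  continuous (fun y : R => 2 * Num.sqrt (r ^+ 2 - y ^+ 2)).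
Proof.
move=> y; apply: cvgM; first exact: cvg_cst.
apply: (@continuous_comp _ _ _ (fun y : R => r ^+ 2 - y ^+ 2) Num.sqrt).
  by apply: is_derive_continuous => x.
exact: sqrt_continuous.
Qed.

Lemma continuous_parabola_chord l h a :
  continuous (fun y : R => 2 * (l * Num.sqrt (1 - (y - a) / h))).
Proof.
move=> y; apply: cvgM; first exact: cvg_cst.
apply: cvgM; first exact: cvg_cst.
apply: (@continuous_comp _ _ _ (fun y : R => 1 - (y - a) / h) Num.sqrt).
  by apply: is_derive_continuous => x.
exact: sqrt_continuous.
Qed.

(** The substitution y = r cos x turns the integral into that of
    2 r^2 sin^2 x, which avoids the vertical tangent of the half-chord at y = r. *)
Lemma integral_semichord r (th : R) : 0 < r -> 0 <= th <= pi ->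
  (\int[length R]_(y in `[(r * cos th)%R, r]) (2 * Num.sqrt (r ^+ 2 - y ^+ 2))%:E
   = (r ^+ 2 * (th - sin th * cos th))%:E)%E.
Proof.
move=> r0 /andP[th0 thpi].
have dF (x : R) : is_derive x 1 (fun x => r * cos x) (r * - sin x).
  by apply: is_derive_eq; rewrite /GRing.scale/=; ring.
have dH (x : R) : is_derive x 1 (fun x => r ^+ 2 * (x - sin x * cos x)) (2 * r ^+ 2 * (sin x) ^+ 2).
  by apply: is_derive_eq; rewrite /GRing.scale/=; have := cos2Dsin2 x; nra.
have := substitution_smooth th0 _ dF _ (G := fun y => 2 * Num.sqrt (r ^+ 2 - y ^+ 2)).
rewrite cos0 mulr1 => ->.
- have := FTC2_smooth th0 dH.
  rewrite sin0 mul0r subr0 mulr0 subr0 => <-.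
    apply: eq_integral => x; rewrite inE/= in_itv/= => /andP[x0 xth].
    have sx : 0 <= sin x by apply: sin_ge0_pi; rewrite x0 (le_trans xth).
    have -> : r ^+ 2 - (r * cos x) ^+ 2 = (r * sin x) ^+ 2.
      by rewrite !exprMn sin2cos2; ring.
    rewrite sqrtr_sqr ger0_norm ?mulr_ge0// ?ltW//.
    by congr (_%:E); ring.
  by apply: is_derive_continuous => x.
- move=> x y; rewrite !in_itv/= => /andP[x0 xt] /andP[y0 yt] xy.
  by rewrite ltr_pM2l// ltr_cos// in_itv/= ?x0 ?y0 (le_trans _ thpi).
- by apply: is_derive_continuous => x.
- exact: continuous_semichord.
Qed.

(** Archimedes: a parabolic segment of half-base l and height h.  The
    substitution y = a + h (1 - x^2) removes the square root. *)
Lemma integral_parabola_chord l h a : 0 < h ->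
  (\int[length R]_(y in `[a, (a + h)%R]) (2 * (l * Num.sqrt (1 - (y - a) / h)))%:E
   = (4 / 3 * l * h)%:E)%E.
Proof.
move=> h0.
have dF (x : R) : is_derive x 1 (fun x => a + h * (1 - x ^+ 2)) (- (2 * h * x)).
  by apply: is_derive_eq; rewrite /GRing.scale/=; ring.
have dH (x : R) : is_derive x 1 (fun x => 4 / 3 * l * h * x ^+ 3) (4 * l * h * x ^+ 2).
  by apply: is_derive_eq; rewrite /GRing.scale/=; field.
have := substitution_smooth ler01 _ dF _ (G := fun y => 2 * (l * Num.sqrt (1 - (y - a) / h))).
rewrite expr1n subrr mulr0 expr0n/= subr0 mulr1 addr0 => ->.
- have := FTC2_smooth ler01 dH.
  rewrite expr1n expr0n/= mulr0 subr0 mulr1 => <-.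
    apply: eq_integral => x; rewrite inE/= in_itv/= => /andP[x0 x1].
    have -> : 1 - (a + h * (1 - x ^+ 2) - a) / h = x ^+ 2 by field; rewrite gt_eqF.
    by rewrite sqrtr_sqr ger0_norm//; congr (_%:E); ring.
  by apply: is_derive_continuous => x.
- move=> x y; rewrite !in_itv/= => /andP[x0 xt] /andP[y0 yt] xy.
  by rewrite ltrD2l ltr_pM2l// ltrD2l ltrN2 ltr_pXn2r.
- by apply: is_derive_continuous => x.
- exact: continuous_parabola_chord.
Qed.

Lemma integral_linear c h : 0 <= h ->
  (\int[length R]_(y in `[0%R, h]) (2 * (c * y))%:E = (c * h ^+ 2)%:E)%E.
Proof.
move=> h0.
have dH (x : R) : is_derive x 1 (fun x => c * x ^+ 2) (2 * (c * x)).
  by apply: is_derive_eq; rewrite /GRing.scale/=; ring.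
have := FTC2_smooth h0 dH; rewrite expr0n/= mulr0 subr0; apply.
by apply: is_derive_continuous => x.
Qed.

Lemma integral_ball_slices r c a b : a <= b ->
  (\int[length R]_(z in `[a, b]) (pi * (r ^+ 2 - (z - c) ^+ 2))%:E =
   (pi * (r ^+ 2 * (b - a) - ((b - c) ^+ 3 - (a - c) ^+ 3) / 3))%:E)%E.
Proof.
move=> ab.
have dH (x : R) : is_derive x 1 (fun x => pi * (r ^+ 2 * x - (x - c) ^+ 3 / 3))
    (pi * (r ^+ 2 - (x - c) ^+ 2)).
  by apply: is_derive_eq; rewrite /GRing.scale/=; field.
rewrite (FTC2_smooth ab dH); first by congr (_%:E); field.
by apply: is_derive_continuous => x.
Qed.

Lemma continuous_ball_slices r c : continuous (fun z : R => pi * (r ^+ 2 - (z - c) ^+ 2)).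
Proof. by apply: is_derive_continuous => x. Qed.

End calculus.


(** * Trigonometric inequalities *)
Section trigonometry.
Context {R : realType}.

(** A concave function that is nonnegative at both ends of an interval. *)
Lemma concave_ge0 (g g1 g2 : R -> R) (a b x : R) :
  (forall x : R, is_derive x 1 g (g1 x)) -> (forall x : R, is_derive x 1 g1 (g2 x)) ->
  (forall x, a < x < b -> g2 x <= 0) -> 0 <= g a -> 0 <= g b -> a <= x <= b -> 0 <= g x.
Proof.
move=> dg dg1 g2le ga gb /andP[]; rewrite le_eqVlt => /predU1P[<-//|ax].
rewrite le_eqVlt => /predU1P[->//|xb]; rewrite leNgt; apply/negP => gx.
have cg := is_derive_continuous dg; have cg1 := is_derive_continuous dg1.
have [c /[!in_itv]/= /andP[ac cx] ec] := MVT ax (fun y _ => dg y) (continuous_subspaceT cg).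
have [d /[!in_itv]/= /andP[xd db] ed] := MVT xb (fun y _ => dg y) (continuous_subspaceT cg).
have cd : c < d by exact: lt_trans xd.
have [e /[!in_itv]/= /andP[ce ef] ee] := MVT cd (fun y _ => dg1 y) (continuous_subspaceT cg1).
have : g2 e <= 0 by apply: g2le; rewrite (lt_trans ac ce) (lt_trans ef db).
have : g1 c < 0 by rewrite -(pmulr_llt0 _ (x := x - a)) ?subr_gt0// -ec; lra.
have : 0 < g1 d by rewrite -(pmulr_lgt0 _ (x := b - x)) ?subr_gt0// -ed; lra.
nra.
Qed.

Lemma sqrt3_gt0 : 0 < Num.sqrt 3 :> R. Proof. by rewrite sqrtr_gt0. Qed.

Lemma sqr_sqrt3 : Num.sqrt 3 ^+ 2 = 3 :> R. Proof. by rewrite sqr_sqrtr. Qed.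

Lemma sin_pi6 : sin (pi / 6) = 2^-1 :> R.
Proof.
have c0 : 0 < cos (pi / 6) :> R.
  by apply: cos_gt0_pihalf; have := @pi_gt0 R; lra.
have : sin (pi / 6 *+ 2) = cos (pi / 6) :> R.
  have -> : pi / 6 *+ 2 = - (pi / 6) + pi / 2 :> R by rewrite mulr2n; lra.
  by rewrite sinDpihalf cosN.
by rewrite sin_mulr2n mulr2n => e; nra.
Qed.

Lemma cos_pi6 : cos (pi / 6) = Num.sqrt 3 / 2 :> R.
Proof.
have c0 : 0 < cos (pi / 6) :> R.
  by apply: cos_gt0_pihalf; have := @pi_gt0 R; lra.
have := cos2Dsin2 (pi / 6 : R); rewrite sin_pi6.
have := sqr_sqrt3; have := sqrt3_gt0; nra.
Qed.

Lemma cos_pi4 : cos (pi / 4) = Num.sqrt 2 / 2 :> R.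
Proof.
have c0 : 0 < cos (pi / 4) :> R.
  by apply: cos_gt0_pihalf; have := @pi_gt0 R; lra.
have e : sin (pi / 4) = cos (pi / 4) :> R.
  by have := sinDpihalf (- (pi / 4) : R); rewrite cosN => <-; congr sin; lra.
have := cos2Dsin2 (pi / 4 : R); rewrite e.
have : 0 < Num.sqrt 2 :> R by rewrite sqrtr_gt0.
have : Num.sqrt 2 ^+ 2 = 2 :> R by rewrite sqr_sqrtr.
nra.
Qed.

Lemma sin_pi4 : sin (pi / 4) = Num.sqrt 2 / 2 :> R.
Proof.
by have := sinDpihalf (- (pi / 4) : R); rewrite cosN cos_pi4 => <-; congr sin; lra.
Qed.

(** From sin x <= x at pi / 6. *)
Lemma pi_ge3 : 3 <= pi :> R.
Proof.
have p6 : 0 < pi / 6 :> R by have := @pi_gt0 R; lra.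
have [c _] := MVT p6 (fun y _ => is_derive_sin y) (continuous_subspaceT (@continuous_sin R)).
rewrite sin_pi6 sin0 !subr0 => e; have := cos_le1 c; nra.
Qed.

(** From x <= tan x at pi / 6: the function sin x - x cos x increases. *)
Lemma pi_le_2sqrt3 : pi <= 2 * Num.sqrt 3 :> R.
Proof.
have pi0 := @pi_gt0 R.
have p6 : 0 < pi / 6 :> R by lra.
have dg (x : R) : is_derive x 1 (fun x => sin x - x * cos x) (x * sin x).
  by apply: is_derive_eq; rewrite /GRing.scale/=; ring.
have [c] := MVT p6 (fun y _ => dg y) (continuous_subspaceT (is_derive_continuous dg)).
rewrite in_itv/= => /andP[c0 c6].
have sc : 0 < sin c by apply: sin_gt0_pi; rewrite c0/=; lra.
rewrite sin_pi6 cos_pi6 sin0 mul0r !subr0 => e.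
have : 0 < c * sin c * (pi / 6) by rewrite !mulr_gt0.
rewrite -e; clear; move: (@pi R) => p h.
have s0 := sqrt3_gt0; have s2 := sqr_sqrt3.
have : p * Num.sqrt 3 < 6 by lra.
nra.
Qed.

(** The right-hand side is the area of the isosceles triangle of legs 2 / sqrt 3
    and half-angle th.  It is a concave function of th, and equality holds at 0
    and at pi / 6. *)
Lemma triangle_bound (th : R) : 0 <= th <= pi / 6 ->
  2 * Num.sqrt 3 / pi * th <= 4 / 3 * (sin th * cos th).
Proof.
move=> /[dup] /andP[th0 th6] thb; rewrite -subr_ge0.
pose k : R := 2 * Num.sqrt 3 / pi.
apply: (@concave_ge0 (fun x => 4 / 3 * (sin x * cos x) - k * x)
  (fun x => 4 / 3 * (cos x ^+ 2 - sin x ^+ 2) - k)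
  (fun x => - (16 / 3) * (sin x * cos x)) 0 (pi / 6)) => //.
- by move=> x; apply: is_derive_eq; rewrite /GRing.scale/=; ring.
- by move=> x; apply: is_derive_eq; rewrite /GRing.scale/=; ring.
- move=> x /andP[x0 x6]; have pi0 := @pi_gt0 R.
  have : 0 < sin x by apply: sin_gt0_pi; lra.
  have : 0 < cos x by apply: cos_gt0_pihalf; lra.
  nra.
- by rewrite sin0 mul0r !mulr0 subrr.
- rewrite sin_pi6 cos_pi6 /k subr_ge0 le_eqVlt; apply/orP; left; apply/eqP.
  by move: (@pi R) (@pi_gt0 R) => p p0; field; exact: lt0r_neq0.
Qed.

(** The right-hand side is the area of the triangle of [triangle_bound] plus that
    of a parabolic segment on its base that reaches the unit circle.  Its second
    derivative has the sign of 2 cos th - sqrt 3, so that it is concave from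
    pi / 6 on.  At pi / 6 there is equality; at pi / 4 the left-hand side is
    smaller by less than a thousandth, so a cruder estimate of the area would
    not do. *)
Lemma parabola_bound (th : R) : pi / 6 <= th <= pi / 4 ->
  2 * Num.sqrt 3 / pi * th <= 4 / 9 * (sin th * (2 * Num.sqrt 3 - cos th)).
Proof.
move=> thb; rewrite -subr_ge0.
pose k : R := 2 * Num.sqrt 3 / pi.
have [s0 s2] := (sqrt3_gt0, sqr_sqrt3).
apply: (@concave_ge0 (fun x => 4 / 9 * (sin x * (2 * Num.sqrt 3 - cos x)) - k * x)
  (fun x => 4 / 9 * (cos x * (2 * Num.sqrt 3 - cos x) + sin x ^+ 2) - k)
  (fun x => 8 / 9 * (sin x * (2 * cos x - Num.sqrt 3))) (pi / 6) (pi / 4)) => //.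
- by move=> x; apply: is_derive_eq; rewrite /GRing.scale/=; ring.
- by move=> x; apply: is_derive_eq; rewrite /GRing.scale/=; ring.
- move=> x /andP[x0 x6]; have pi0 := @pi_gt0 R.
  have : 0 < sin x by apply: sin_gt0_pi; lra.
  have : cos x < Num.sqrt 3 / 2.
    by rewrite -cos_pi6 ltr_cos// in_itv/=; lra.
  nra.
- rewrite sin_pi6 cos_pi6 /k subr_ge0 le_eqVlt; apply/orP; left; apply/eqP.
  by move: (@pi R) (@pi_gt0 R) => p p0; field; exact: lt0r_neq0.
- rewrite sin_pi4 cos_pi4 /k.
  have -> : 2 * Num.sqrt 3 / pi * (pi / 4) = Num.sqrt 3 / 2 :> R.
    by move: (@pi R) (@pi_gt0 R) => p p0; field; exact: lt0r_neq0.
  have : 0 < Num.sqrt 2 :> R by rewrite sqrtr_gt0.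
  have : Num.sqrt 2 ^+ 2 = 2 :> R by rewrite sqr_sqrtr.
  set v := Num.sqrt 2; set u := Num.sqrt 3 in s0 s2 * => v2 v0.
  have : v * u = v * u by [].
  have uu : 1732 / 1000 < u < 1733 / 1000 by nra.
  have vv : 14142 / 10000 < v < 14143 / 10000 by nra.
  nra.
Qed.

End trigonometry.


(** * Measuring a set by its sections *)
Section measurable_comparisons.
Context {R : realType}.

Lemma measurable_lt_set d (T : measurableType d) (f g : T -> R) :
  measurable_fun setT f -> measurable_fun setT g -> measurable [set x | f x < g x].
Proof.
move=> mf mg; rewrite -[X in measurable X]setTI.
by have := measurable_fun_ltr mf mg measurableT (Y := [set true]); apply.
Qed.

Lemma measurable_le_set d (T : measurableType d) (f g : T -> R) :
  measurable_fun setT f -> measurable_fun setT g -> measurable [set x | f x <= g x].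
Proof.
move=> mf mg; rewrite -[X in measurable X]setTI.
by have := measurable_fun_ler mf mg measurableT (Y := [set true]); apply.
Qed.

End measurable_comparisons.

Section slicing.
Context d1 d2 (T1 : measurableType d1) (T2 : measurableType d2) (R : realType).
Variable m1 : {sigma_finite_measure set T1 -> \bar R}.
Variable m2 : {sigma_finite_measure set T2 -> \bar R}.
Implicit Types A : set (T1 * T2).

Lemma ysectionE A y : ysection A y = [set x | A (x, y)].
Proof. by apply/seteqP; split => x; rewrite /ysection/= inE. Qed.

Lemma measurable_slice A y : measurable A -> measurable [set x | A (x, y)].
Proof. by move=> mA; rewrite -ysectionE; exact: measurable_ysection. Qed.

Lemma ge_slices A (D : set T2) (f : T2 -> R) : measurable A -> measurable D ->
  measurable_fun D f ->
  (forall y, D y -> 0 <= f y) ->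
  (forall y, D y -> ((f y)%:E <= m1 [set x | A (x, y)])%E) ->
  (\int[m2]_(y in D) (f y)%:E <= (m1 \x m2) A)%E.
Proof.
move=> mA mD mf f0 fA; rewrite product_measureC// /product_measure2/=.
apply: (@le_trans _ _ (\int[m2]_(y in D) ((m1 \o ysection A) y))%E).
  apply: ge0_le_integral => //.
  - exact/measurable_EFinP.
  - by apply: measurable_funTS; exact: measurable_fun_ysection.
  - by move=> y Dy /=; rewrite ysectionE; exact: fA.
by apply: ge0_subset_integral => //; exact: measurable_fun_ysection.
Qed.

Lemma le_slices A (D : set T2) (f : T2 -> R) : measurable A -> measurable D ->
  measurable_fun D f ->
  (forall x y, A (x, y) -> D y) ->
  (forall y, D y -> (m1 [set x | A (x, y)] <= (f y)%:E)%E) ->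
  ((m1 \x m2) A <= \int[m2]_(y in D) (f y)%:E)%E.
Proof.
move=> mA mD mf AD fA; rewrite product_measureC// /product_measure2/=.
rewrite [leLHS](_ : _ = \int[m2]_(y in D) ((m1 \o ysection A) y))%E.
  apply: ge0_le_integral => //.
  - by apply: measurable_funTS; exact: measurable_fun_ysection.
  - exact/measurable_EFinP.
  - by move=> y Dy /=; rewrite ysectionE; exact: fA.
rewrite [RHS]integral_mkcond; apply: eq_integral => y _ /=; rewrite patchE.
case: ifPn => // /negP yD; rewrite ysectionE (_ : [set x | _] = set0) ?measure0//.
by apply/seteqP; split => x //= /AD yD'; apply: yD; rewrite inE.
Qed.

End slicing.

Section interval_length.
Context {R : realType}.

Lemma length_oo (a b : R) : a <= b -> length R `]a, b[ = (b - a)%:E.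
Proof.
rewrite le_eqVlt => /predU1P[->|ab]; first by rewrite set_itv_ge ?bnd_simp ?ltxx// measure0 subrr.
by rewrite lebesgue_measure_itv/= lte_fin ab EFinB.
Qed.

End interval_length.

(** * Discs and circular segments *)
Section disc.
Context {R : realType}.

Definition disc (r : R) : set (R * R) := [set p | p.1 ^+ 2 + p.2 ^+ 2 < r ^+ 2].

Lemma measurable_disc r : measurable (disc r).
Proof. by apply: measurable_lt_set; mfun. Qed.

Definition cap (r h : R) : set (R * R) := disc r `&` [set p | h <= p.2].

Lemma measurable_cap r h : measurable (cap r h).
Proof. by apply: measurableI; [exact: measurable_disc|apply: measurable_le_set; mfun]. Qed.

Lemma disc_slice (r y : R) : 0 <= r -> `|y| <= r ->
  length R [set x | disc r (x, y)] = (2 * Num.sqrt (r ^+ 2 - y ^+ 2))%:E.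
Proof.
move=> r0 yr; set s := Num.sqrt _.
have s0 : 0 <= s by exact: sqrtr_ge0.
have s2 : s ^+ 2 = r ^+ 2 - y ^+ 2.
  by rewrite sqr_sqrtr//; move: yr; rewrite ler_norml => /andP[? ?]; nra.
rewrite (_ : [set x | _] = `]- s, s[%classic); last first.
  apply/seteqP; split => x; rewrite /disc/= in_itv/=.
    by rewrite -ltrBrDr -s2 => xs; apply/andP; split; nra.
  by move=> /andP[? ?]; rewrite -ltrBrDr -s2; nra.
by rewrite length_oo; [congr (_%:E); ring|lra].
Qed.

Lemma area_cap (r th : R) : 0 < r -> 0 <= th <= pi ->
  area R (cap r (r * cos th)) = (r ^+ 2 * (th - sin th * cos th))%:E.
Proof.
move=> r0 thp; rewrite -(integral_semichord r0 thp).
have mf : measurable_fun `[r * cos th, r] (fun y : R => 2 * Num.sqrt (r ^+ 2 - y ^+ 2)).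
  by apply: measurable_funTS; apply: continuous_measurable_fun; exact: continuous_semichord.
have c1 := cos_geN1 th; have c2 := cos_le1 th.
have yr (y : R) : y \in `[r * cos th, r] -> `|y| <= r.
  by rewrite in_itv/= => /andP[ry yr]; rewrite ler_norml yr andbT; nra.
have cE y : y \in `[r * cos th, r] ->
    [set x | cap r (r * cos th) (x, y)] = [set x | disc r (x, y)].
  rewrite in_itv/= => /andP[ry _]. 
  by apply/seteqP; split => x; rewrite /cap/= => // -[].
apply/eqP; rewrite eq_le; apply/andP; split.
  apply: (@le_slices _ _ _ _ _ (length R) (length R)) => //; first exact: measurable_cap.
    move=> x y [/= + ry]; rewrite /disc/= in_itv/= ry/= => xy.
    by rewrite leNgt; apply/negP => yr'; nra.
  by move=> y Dy; rewrite cE// -(disc_slice (ltW r0) (yr y Dy)).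
apply: (@ge_slices _ _ _ _ _ (length R) (length R)) => //; first exact: measurable_cap.
by move=> y Dy; rewrite cE// -(disc_slice (ltW r0) (yr y Dy)).
Qed.

Lemma area_disc (r : R) : 0 < r -> area R (disc r) = (pi * r ^+ 2)%:E.
Proof.
move=> r0; transitivity (area R (cap r (r * cos pi))).
  congr (area R _); rewrite cospi; apply/seteqP; split => [[x y]|[x y] []//].
  by rewrite /cap/= => d; split => //=; move: d; rewrite /disc/= => d; nra.
rewrite area_cap ?pi_ge0 ?lexx// sinpi mul0r subr0; congr (_%:E); ring.
Qed.

End disc.


(** * The region cut off by a parabola *)
Section conic.
Context {R : realType}.
Implicit Types (a b : R * R) (N r th : R).

(** The circumradius of the equilateral triangle of side 2: a ball of smaller
    radius cannot contain three points with mutual distances at least 2. *)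
Definition rho : R := 2 / Num.sqrt 3.

Lemma rhoE : rho = 2 / Num.sqrt 3. Proof. by []. Qed.

Lemma rho_gt0 : 0 < rho. Proof. by rewrite divr_gt0// sqrt3_gt0. Qed.

Lemma sqr_rho : rho ^+ 2 = 4 / 3.
Proof. by rewrite /rho exprMn exprVn sqr_sqrt3; field. Qed.

Lemma rho_bounds : 1 < rho < 4 / 3.
Proof. by have := rho_gt0; have := sqr_rho => ? ?; apply/andP; split; nra. Qed.

(** If z is the point of a line that is nearest to the origin, v a unit direction
    of the line, a and b the horizontal parts of z and v, and N = |z|^2, then
    |y|^2 + conic a b N y is the squared distance of the point (y, 0) from the
    line.  So the points with nonpositive value are those that are as close to
    the line as to the origin. *)
Definition conic a b N (y : R * R) : R :=
  N - 2 * (y.1 * a.1 + y.2 * a.2) - (y.1 * b.1 + y.2 * b.2) ^+ 2.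

Lemma measurable_conic a b N : measurable_fun setT (conic a b N).
Proof. by rewrite /conic; mfun. Qed.

Definition cutoff a b N : set (R * R) := disc rho `&` [set y | conic a b N y <= 0].

Lemma measurable_cutoff a b N : measurable (cutoff a b N).
Proof.
apply: measurableI; first exact: measurable_disc.
by apply: measurable_le_set; [exact: measurable_conic|exact: measurable_cst].
Qed.

Definition sector r th : set (R * R) :=
  disc r `&` [set y | `|y.1| * cos th < y.2 * sin th].

Lemma measurable_sector r th : measurable (sector r th).
Proof.
apply: measurableI; first exact: measurable_disc.
apply: measurable_lt_set; mfun.
Qed.

(** Below height r cos th the horizontal sections are bounded by the two rays,
    above it by the circle. *)
Lemma area_sector_ge r th : 0 < r -> 0 < th < pi / 2 ->
  ((r ^+ 2 * th)%:E <= area R (sector r th))%E.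
Proof.
move=> r0 /andP[th0 th2].
have pi0 := @pi_gt0 R.
have s0 : 0 < sin th by apply: sin_gt0_pi; lra.
have c0 : 0 < cos th by apply: cos_gt0_pihalf; lra.
have cs := cos2Dsin2 th.
set s := sin th in s0 cs *; set c := cos th in c0 cs *.
have mS := measurable_sector r th.
pose B := [set y : R * R | r * c <= y.2].
have mB : measurable B by apply: measurable_le_set; mfun.
rewrite -(setIT (sector r th)) -(setUv B) setIUr measureU//=; last 3 first.
- exact: measurableI.
- by apply: measurableI => //; exact: measurableC.
- by rewrite setIACA setICr setI0.
rewrite (_ : (r ^+ 2 * th)%:E =
  (r ^+ 2 * (th - s * c))%:E + (s / c * (r * c) ^+ 2)%:E)%E; last first.
  by rewrite -EFinD; congr (_%:E); field; rewrite gt_eqF.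
apply: leeD.
  rewrite -(@area_cap _ r th) //; last by lra.
  apply: le_measure; rewrite ?inE//; [exact: measurable_cap|exact: measurableI|].
  move=> [x y]; rewrite /cap/B/sector/disc/= -/c -/s => -[xy ry]; split => //; split => //.
  rewrite -ltr_sqr ?nnegrE ?mulr_ge0 ?(ltW s0) ?(ltW c0)//; last by nra.
  rewrite !exprMn real_normK ?num_real//.
  have h1 : (r * c) ^+ 2 <= y ^+ 2 by rewrite ler_sqr ?nnegrE//; nra.
  have h2 : c ^+ 2 * (x ^+ 2 + y ^+ 2) < c ^+ 2 * r ^+ 2 by rewrite ltr_pM2l ?exprn_gt0.
  by rewrite exprMn in h1; nra.
rewrite -integral_linear ?mulr_ge0 ?(ltW r0) ?(ltW c0)//.
rewrite -integral_itv_bndo_bndc; last first.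
  by apply/measurable_EFinP; apply: measurable_funM => //; apply: measurable_funM.
have mSB : measurable (sector r th `&` ~` B).
  by apply: measurableI => //; exact: measurableC.
apply: (@ge_slices _ _ _ _ _ (length R) (length R)) => //.
- by apply: measurable_funM => //; apply: measurable_funM.
- move=> y; rewrite /= in_itv/= => /andP[y0 yrc].
  by rewrite !mulr_ge0// ?invr_ge0 ltW.
- move=> y; rewrite /= in_itv/= => /andP[y0 yrc].
  have k0 : 0 < s / c by rewrite divr_gt0.
  have -> : 2 * (s / c * y) = s / c * y - (- (s / c * y)) by ring.
  rewrite -length_oo; last by nra.
  apply: le_measure; rewrite ?inE//; first exact: measurable_slice mSB.
  move=> x; rewrite /= in_itv/= /B /= => /andP[x1 x2]; split; last first.
    by apply/negP; rewrite -ltNge.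
  have xc : `|x| * c < y * s.
    by rewrite -ltr_pdivlMr// -mulrA mulrC ltr_norml x1 x2.
  split => //; rewrite /disc/=.
  have := xc; rewrite -ltr_sqr ?nnegrE ?mulr_ge0 ?(ltW s0) ?(ltW c0)//.
  rewrite !exprMn real_normK ?num_real// => x2c.
  have y2 : y ^+ 2 < (r * c) ^+ 2.
    by rewrite ltr_sqr ?nnegrE// mulr_ge0 ?ltW.
  rewrite exprMn in y2.
  have ycs : y ^+ 2 * c ^+ 2 + y ^+ 2 * s ^+ 2 = y ^+ 2 by rewrite -mulrDr cs mulr1.
  by rewrite -(ltr_pM2r (x := c ^+ 2)) ?exprn_gt0// mulrDl; lra.
Qed.

(** The fraction of the disc of radius [rho] that lies outside the inscribed
    regular hexagon, which is also circumscribed about the unit circle. *)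
Definition kappa : R := 1 - 3 * Num.sqrt 3 / (2 * pi).

Lemma kappa_ge0 : 0 <= kappa.
Proof.
rewrite /kappa subr_ge0 ler_pdivrMr ?mulr_gt0 ?pi_gt0// mul1r.
by have := @pi_ge3 R; have := @sqrt3_gt0 R; have := @sqr_sqrt3 R; nra.
Qed.

(** Coordinates in which the parabola meets the circle of radius [rho] at two
    points symmetric with respect to the second axis, at angles - th and th. *)
Section chord_frame.
Variables (a b : R * R) (N th : R).
Let s := sin th.
Let c := cos th.
Hypothesis th_range : 0 < th < pi / 4.
Hypothesis chord_l : conic a b N (- (rho * s), rho * c) = 0.
Hypothesis chord_r : conic a b N (rho * s, rho * c) = 0.
Hypothesis unit_top : 0 <= conic a b N (0, 1).
Hypothesis b_le1 : b.1 ^+ 2 + b.2 ^+ 2 <= 1.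
Hypothesis a_large : rho < a.2.

Let cs : c ^+ 2 + s ^+ 2 = 1. Proof. exact: cos2Dsin2. Qed.
Let s0 : 0 < s.
Proof. by case/andP: th_range => ? ?; apply: sin_gt0_pi; have := @pi_gt0 R; lra. Qed.
Let c0 : 0 < c.
Proof. by case/andP: th_range => ? ?; apply: cos_gt0_pihalf; have := @pi_gt0 R; lra. Qed.
Let rho0 := rho_gt0.

Let q := - 2 * a.2 - 2 * b.2 ^+ 2 * (rho * c).
Let E (x y : R) : R :=
  b.1 ^+ 2 * (y + rho * c) - b.2 ^+ 2 * (y - rho * c) - 2 * b.1 * b.2 * x + q.

Lemma chord_conicE (x y : R) : conic a b N (x, y) =
  b.1 ^+ 2 * (rho * s) ^+ 2 + q * (y - rho * c) - (b.1 * x + b.2 * (y - rho * c)) ^+ 2.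
Proof.
have a1 : a.1 = - (rho * c) * b.1 * b.2.
  have l0 : 0 < rho * s by rewrite mulr_gt0.
  apply: (mulfI (lt0r_neq0 l0)).
  by move: chord_l chord_r; rewrite /conic/=; lra.
move: chord_r; rewrite /conic/q/= a1 => cr.
transitivity (N - 2 * (x * (- (rho * c) * b.1 * b.2) + y * a.2) -
  (x * b.1 + y * b.2) ^+ 2 - 0); first by ring.
by rewrite -cr; ring.
Qed.

(** The conic vanishes at the two common points of the circle and the chord, so
    it is a combination of the equation of the circle and of a degenerate conic
    containing the chord; [E] is the equation of the other line of the latter.
    This gives the sign of the conic on either side of the chord. *)
Lemma chord_conic_factor (x y : R) : conic a b N (x, y) =
  b.1 ^+ 2 * (rho ^+ 2 - x ^+ 2 - y ^+ 2) + (y - rho * c) * E x y.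
Proof.
rewrite chord_conicE /E.
have -> : (rho * s) ^+ 2 = rho ^+ 2 * (1 - c ^+ 2) by rewrite exprMn -cs; ring.
ring.
Qed.

(** The affine form [E] is at most rho + rho on the disc, up to its constant
    term - 2 a.2, and the line is far enough for that term to dominate. *)
Lemma chord_factor_lt0 (x y : R) : x ^+ 2 + y ^+ 2 <= rho ^+ 2 -> E x y < 0.
Proof.
move=> xy; rewrite /E/q.
have c1 : c <= 1 by exact: cos_le1.
pose k := b.1 ^+ 2 + b.2 ^+ 2.
have k1 : k <= 1 := b_le1.
have k0 : 0 <= k by rewrite addr_ge0 ?sqr_ge0.
(* the two coefficients of the affine form have norm k, by the double angle
   formulas, so Cauchy-Schwarz bounds it on the disc *)
have CS : (b.1 ^+ 2 - b.2 ^+ 2) * y - 2 * b.1 * b.2 * x <= k * rho.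
  rewrite leNgt; apply/negP => h.
  have h2 : (k * rho) ^+ 2 < ((b.1 ^+ 2 - b.2 ^+ 2) * y - 2 * b.1 * b.2 * x) ^+ 2.
    by rewrite ltr_sqr// ?nnegrE ?mulr_ge0 ?(ltW rho0)// (le_trans _ (ltW h))// mulr_ge0// ltW.
  have h3 : ((b.1 ^+ 2 - b.2 ^+ 2) * y - 2 * b.1 * b.2 * x) ^+ 2 +
     ((b.1 ^+ 2 - b.2 ^+ 2) * x + 2 * b.1 * b.2 * y) ^+ 2 = k ^+ 2 * (x ^+ 2 + y ^+ 2).
    by rewrite /k; ring.
  have h4 : k ^+ 2 * (x ^+ 2 + y ^+ 2) <= k ^+ 2 * rho ^+ 2 by rewrite ler_wpM2l ?sqr_ge0.
  have := sqr_ge0 ((b.1 ^+ 2 - b.2 ^+ 2) * x + 2 * b.1 * b.2 * y).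
  by rewrite exprMn in h2; lra.
have kr : k * rho <= rho by rewrite ler_piMl// ltW.
have rc : rho * c <= rho by rewrite ler_piMr// ltW.
have rc0 : 0 < rho * c by rewrite mulr_gt0.
have b2 := sqr_ge0 b.2; have b1 := sqr_ge0 b.1.
have : (b.1 ^+ 2 - b.2 ^+ 2) * (rho * c) <= rho.
  have := b_le1; nra.
have := a_large; set u := (b.1 ^+ 2 - b.2 ^+ 2) * (rho * c).
set v := (b.1 ^+ 2 - b.2 ^+ 2) * y - 2 * b.1 * b.2 * x in CS.
move=> al ur; rewrite (_ : _ + _ = v + u - 2 * a.2); first by lra.
by rewrite /u /v; ring.
Qed.

Lemma cutoff_above_chord (x y : R) : cutoff a b N (x, y) -> rho * c <= y.
Proof.
move=> [xy /= ck]; rewrite leNgt; apply/negP => yc; move: ck; rewrite chord_conic_factor.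
have e0 : E x y < 0 by apply: chord_factor_lt0; exact: ltW.
have : 0 <= b.1 ^+ 2 * (rho ^+ 2 - x ^+ 2 - y ^+ 2).
  by rewrite mulr_ge0 ?sqr_ge0//; move: xy; rewrite /disc/=; lra.
have : 0 < (y - rho * c) * E x y by rewrite nmulr_lgt0// subr_lt0.
lra.
Qed.

Lemma sector_reaches_cutoff (y : R * R) : sector rho th y ->
  exists k : R, [/\ 0 < k, (k * y.1) ^+ 2 + (k * y.2) ^+ 2 = rho ^+ 2 &
    conic a b N (k * y.1, k * y.2) < 0].
Proof.
case: y => [x y] [/= xy xs]; rewrite -/c -/s in xs.
have y0 : 0 < y.
  by rewrite -(pmulr_lgt0 _ s0); apply: le_lt_trans xs; rewrite mulr_ge0// ltW.
pose n := Num.sqrt (x ^+ 2 + y ^+ 2).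
have n2 : n ^+ 2 = x ^+ 2 + y ^+ 2 by rewrite sqr_sqrtr ?addr_ge0 ?sqr_ge0.
have n0 : 0 < n by rewrite sqrtr_gt0 ltr_wpDl ?sqr_ge0 ?exprn_gt0.
exists (rho / n).
have e : (rho / n * x) ^+ 2 + (rho / n * y) ^+ 2 = rho ^+ 2.
  transitivity (rho ^+ 2 * (x ^+ 2 + y ^+ 2) / n ^+ 2); first by field; rewrite lt0r_neq0.
  by rewrite -n2 mulfK// lt0r_neq0// exprn_gt0.
split => //; first by rewrite divr_gt0.
rewrite chord_conic_factor.
have -> : rho ^+ 2 - (rho / n * x) ^+ 2 - (rho / n * y) ^+ 2 = 0 by rewrite -e; ring.
rewrite mulr0 add0r pmulr_rlt0; first by apply: chord_factor_lt0; rewrite e.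
rewrite subr_gt0 (mulrAC rho n^-1 y) -(mulrA rho y) ltr_pM2l// ltr_pdivlMr//.
rewrite -ltr_sqr ?nnegrE ?mulr_ge0 ?(ltW c0) ?(ltW n0) ?(ltW y0)//.
have : (`|x| * c) ^+ 2 < (y * s) ^+ 2.
  by rewrite ltr_sqr ?nnegrE ?mulr_ge0 ?(ltW s0) ?(ltW y0) ?(ltW c0).
have ycs : y ^+ 2 * c ^+ 2 + y ^+ 2 * s ^+ 2 = y ^+ 2 by rewrite -mulrDr cs mulr1.
by rewrite !exprMn real_normK ?num_real// n2 mulrDr; lra.
Qed.


(** The half-length of a horizontal section of the region inside the parabola has
    an affine square.  It is l^2 on the chord and nonnegative at the height of the
    top of the unit circle, hence at least l^2 times the fraction of the height
    that remains. *)
Lemma cutoff_free_slice y : rho * c < 1 -> rho * c <= y <= 1 ->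
  ((2 * (rho * s * Num.sqrt (1 - (y - rho * c) / (1 - rho * c))))%:E <=
   length R [set x | (cap rho (rho * c) `\` cutoff a b N) (x, y)])%E.
Proof.
rewrite -subr_gt0; set h := 1 - rho * c => h0 /andP[yc y1].
set Y := y - rho * c; have Y0 : 0 <= Y by rewrite subr_ge0.
have Yh : Y <= h by rewrite lerD2r.
set l := rho * s; have l0 : 0 < l by rewrite mulr_gt0.
set m := Num.sqrt _.
have m0 : 0 <= m by exact: sqrtr_ge0.
have m2 : m ^+ 2 = 1 - Y / h.
  by rewrite sqr_sqrtr// subr_ge0 ler_pdivrMr// mul1r.
have top : b.2 ^+ 2 * h ^+ 2 <= b.1 ^+ 2 * l ^+ 2 + q * h.
  by move: unit_top; rewrite chord_conicE -/h -/l; lra.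
have Yr : y <= 1 by [].
have r1 : 1 < rho by have /andP[] := rho_bounds.
have c_lt : 0 < rho * c by rewrite mulr_gt0.
(* if b.1 vanished, the factored form would make the conic negative at (0, 1) *)
have b1 : b.1 != 0.
  apply/negP => /eqP b10.
  have := unit_top; rewrite chord_conic_factor b10 expr0n mul0r add0r.
  rewrite leNgt pmulr_rlt0// chord_factor_lt0// expr0n add0r expr1n.
  by rewrite -[leLHS](expr1n _ 2) ler_sqr ?nnegrE ?ltW.
have b12 : 0 < b.1 ^+ 2 by rewrite exprn_even_gt0.
pose x0 := - (b.2 / b.1) * Y.
have -> : 2 * (l * m) = x0 + l * m - (x0 - l * m) by ring.
have lm0 : 0 <= l * m := mulr_ge0 (ltW l0) m0.
rewrite -length_oo; last by lra.
have mset : measurable (cap rho (rho * c) `\` cutoff a b N).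
  by apply: measurableD; [exact: measurable_cap|exact: measurable_cutoff].
apply: le_measure; rewrite ?inE//; first exact: measurable_slice mset.
move=> x /=; rewrite in_itv/= => /andP[x1 x2].
have pos : 0 < conic a b N (x, y).
  rewrite chord_conicE -/Y -/l.
  have -> : b.1 * x + b.2 * Y = b.1 * (x - x0) by rewrite /x0; field.
  have xm : (x - x0) ^+ 2 < l ^+ 2 * (1 - Y / h).
    rewrite -m2 -exprMn -[ltLHS]real_normK ?num_real// ltr_sqr ?nnegrE//.
    by rewrite ltr_norml; lra.
  have e : 0 <= Y * (q + b.1 ^+ 2 * l ^+ 2 / h).
    rewrite mulr_ge0// -(pmulr_lge0 _ h0) mulrDl divfK ?lt0r_neq0//.
    have := mulr_ge0 (sqr_ge0 b.2) (sqr_ge0 h); lra.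
  have e2 : b.1 ^+ 2 * (x - x0) ^+ 2 < b.1 ^+ 2 * (l ^+ 2 * (1 - Y / h)) by rewrite ltr_pM2l.
  have ez : Y * (q + b.1 ^+ 2 * l ^+ 2 / h) = q * Y + b.1 ^+ 2 * l ^+ 2 * (Y / h) by ring.
  have e2' : b.1 ^+ 2 * (l ^+ 2 * (1 - Y / h)) =
     b.1 ^+ 2 * l ^+ 2 - b.1 ^+ 2 * l ^+ 2 * (Y / h) by ring.
  by rewrite [X in _ - X]exprMn; rewrite ez in e; rewrite e2' in e2; lra.
split; last first.
  by move=> [_ /=]; rewrite leNgt pos.
split => //; rewrite /disc/= ltNge; apply/negP => out.
(* a point outside the disc would, by concavity along the horizontal line, make
   the conic positive where the line meets the circle, above the chord *)
pose L := Num.sqrt (rho ^+ 2 - y ^+ 2).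
have yr : y ^+ 2 < rho ^+ 2 by rewrite ltr_sqr ?nnegrE; lra.
have L2 : L ^+ 2 = rho ^+ 2 - y ^+ 2 by rewrite sqr_sqrtr// subr_ge0 ltW.
have L0 : 0 < L by rewrite sqrtr_gt0 subr_gt0.
have xL : L <= `|x|.
  by rewrite -ler_sqr ?nnegrE ?(ltW L0)// real_normK ?num_real// L2; lra.
have x0' : 0 < `|x| by exact: lt_le_trans xL.
pose k := L / `|x|.
have k0 : 0 < k by rewrite divr_gt0.
have k1 : k <= 1 by rewrite ler_pdivrMr// mul1r.
have kx : (k * x) ^+ 2 + y ^+ 2 = rho ^+ 2.
  rewrite exprMn -[x ^+ 2]real_normK ?num_real// -exprMn /k divfK ?gt_eqF//.
  by rewrite L2 subrK.
clearbody k.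
have neg : conic a b N (k * x, y) <= 0.
  rewrite chord_conic_factor.
  have -> : rho ^+ 2 - (k * x) ^+ 2 - y ^+ 2 = 0 by rewrite -kx; ring.
  rewrite mulr0 add0r; apply: mulr_ge0_le0 => //.
  by apply: ltW; apply: chord_factor_lt0; rewrite kx.
have mid : 0 <= conic a b N (0, y).
  rewrite chord_conicE -/Y -/l mulr0 add0r [X in _ - X]exprMn.
  have : 0 <= b.1 ^+ 2 * l ^+ 2 by rewrite mulr_ge0 ?sqr_ge0.
  move: top (sqr_ge0 b.2).
  move: (b.1 ^+ 2 * l ^+ 2) (b.2 ^+ 2) q => P Q q' tp Q0 P0.
  rewrite -(pmulr_rge0 _ h0).
  have t1 : 0 <= P * (h - Y) by rewrite mulr_ge0// subr_ge0.
  have t2 : 0 <= Y * (P + q' * h - Q * h ^+ 2) by rewrite mulr_ge0// subr_ge0.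
  have hY : 0 <= h - Y by rewrite subr_ge0.
  have t3 : 0 <= Q * (Y * (h * (h - Y))) by rewrite !mulr_ge0 ?(ltW h0).
  rewrite (_ : h * _ = P * (h - Y) + Y * (P + q' * h - Q * h ^+ 2) +
    Q * (Y * (h * (h - Y)))); last by ring.
  by rewrite !addr_ge0.
have conc : conic a b N (k * x, y) = k * conic a b N (x, y) + (1 - k) * conic a b N (0, y)
    + b.1 ^+ 2 * (k * (1 - k) * x ^+ 2).
  by rewrite /conic/=; ring.
have : 0 < k * conic a b N (x, y) by rewrite mulr_gt0.
have k1' : 0 <= 1 - k by rewrite subr_ge0.
have : 0 <= (1 - k) * conic a b N (0, y) by apply: mulr_ge0.
have : 0 <= b.1 ^+ 2 * (k * (1 - k) * x ^+ 2).
  apply: mulr_ge0; first exact: sqr_ge0.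
  by apply: mulr_ge0; [apply: mulr_ge0 => //; exact: ltW|exact: sqr_ge0].
lra.
Qed.

(** The cut-off region lies in the circular segment above the chord and misses a
    parabolic segment there.  The maximum covers the case of a chord that does
    not enter the unit disc, where nothing is gained. *)
Lemma cutoff_area_bound :
  (area R (cutoff a b N) + (4 / 3 * (rho * s) * Num.max 0 (1 - rho * c))%:E <=
   (rho ^+ 2 * (th - s * c))%:E)%E.
Proof.
have mK := measurable_cutoff a b N; have mC := measurable_cap rho (rho * c).
have pi0 := @pi_gt0 R.
rewrite -(@area_cap _ rho th) ?rho0//; last by case/andP: th_range; lra.
have KC : cutoff a b N `<=` cap rho (rho * c).
  by move=> [x y] K; split; [have [] := K|exact: cutoff_above_chord K].
have -> : area R (cap rho (rho * c)) =
    (area R (cutoff a b N) + area R (cap rho (rho * c) `\` cutoff a b N))%E.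
  rewrite -measureU//=; last 2 first.
  - exact: measurableD.
  - by rewrite setDE setICA setICr setI0.
  by rewrite setDUK.
apply: leeD2l.
have [h0|h0] := leP (1 - rho * c) 0; first by rewrite mulr0.
rewrite -(@integral_parabola_chord _ _ _ (rho * c))// addrC subrK.
apply: (@ge_slices _ _ _ _ _ (length R) (length R)) => //.
- exact: measurableD.
- by apply: measurable_funTS; apply: continuous_measurable_fun; exact: continuous_parabola_chord.
- by move=> y _; rewrite !mulr_ge0// ?sqrtr_ge0 ?(ltW s0) ?(ltW rho0).
- by move=> y /=; rewrite in_itv/= => ?; apply: cutoff_free_slice => //; lra.
Qed.

Lemma cutoff_area_le_sector :
  (area R (cutoff a b N) <= kappa%:E * area R (sector rho th))%E.
Proof.
have pi0 := @pi_gt0 R.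
have th2 : 0 < th < pi / 2 by case/andP: th_range; lra.
have := area_sector_ge rho0 th2; rewrite sqr_rho => h.
apply: le_trans (lee_wpmul2l _ h); rewrite ?lee_fin ?kappa_ge0//.
have := cutoff_area_bound; rewrite -leeBrDr//; move=> /le_trans; apply.
rewrite -EFinB -EFinM lee_fin sqr_rho.
set M := Num.max _ _.
have M0 : 0 <= M by rewrite le_max lexx.
have M1 : 1 - rho * c <= M by rewrite le_max lexx orbT.
have -> : kappa * (4 / 3 * th) = 4 / 3 * th - 2 * Num.sqrt 3 / pi * th.
  rewrite /kappa; move: (@pi R) pi0 => p p0; field; exact: lt0r_neq0.
suff : 2 * Num.sqrt 3 / pi * th <= 4 / 3 * (s * c) + 4 / 3 * (rho * s) * M by lra.
have rs0 : 0 < 4 / 3 * (rho * s) by rewrite !mulr_gt0.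
have [th6|th6] := leP th (pi / 6).
  apply: (@le_trans _ _ (4 / 3 * (s * c))).
    by apply: triangle_bound; rewrite th6 andbT; case/andP: th_range => /ltW.
  by rewrite lerDl mulr_ge0// ltW.
apply: (@le_trans _ _ (4 / 9 * (s * (2 * Num.sqrt 3 - c)))).
  by apply: parabola_bound; rewrite ltW//=; case/andP: th_range => _ /ltW.
have -> : 4 / 9 * (s * (2 * Num.sqrt 3 - c)) = 4 / 3 * (s * c) + 4 / 3 * (rho * s) * (1 - rho * c).
  have -> : 2 * Num.sqrt 3 = 3 * rho :> R.
    have w0 := lt0r_neq0 (@sqrt3_gt0 R); apply: (mulIf w0).
    rewrite -mulrA -expr2 sqr_sqrt3 /rho.
    by move: (Num.sqrt 3) w0 => w w0; field.
  have := sqr_rho; rewrite expr2 => r2.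
  transitivity (4 / 3 * (s * c) + 4 / 3 * rho * s - 4 / 3 * (rho * rho) * s * c); last by ring.
  by rewrite r2; field.
by rewrite lerD2l ler_pM2l.
Qed.

End chord_frame.
End conic.


(** * Sectors subtended by the cut-off regions *)
Section sector_cover.
Context {R : realType}.
Implicit Types (a b : R * R) (N c s : R).
Local Notation rho := (@rho R).
Local Notation kappa := (@kappa R).

(** Every ray in S leaves the disc of radius [rho] at a point that is strictly
    closer to the line than to the origin.  This makes the sets attached to
    distinct lines disjoint, and the last clause then adds up. *)
Definition sector_covers a b N (S : set (R * R)) :=
  [/\ measurable S, S `<=` disc rho,
    forall y, S y -> exists k : R,
      [/\ 0 < k, (k * y.1) ^+ 2 + (k * y.2) ^+ 2 = rho ^+ 2 &
        conic a b N (k * y.1, k * y.2) < 0] &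
    (area R (cutoff a b N) <= kappa%:E * area R S)%E].

Lemma conic_rot2 c s a b N y : c ^+ 2 + s ^+ 2 = 1 ->
  conic (rot2 c s a) (rot2 c s b) N (rot2 c s y) = conic a b N y.
Proof.
case: a b y => [a1 a2] [b1 b2] [y1 y2] cs; rewrite /conic/rot2/=.
transitivity (N - 2 * ((c ^+ 2 + s ^+ 2) * (y1 * a1 + y2 * a2)) -
  ((c ^+ 2 + s ^+ 2) * (y1 * b1 + y2 * b2)) ^+ 2); first by ring.
by rewrite cs !mul1r.
Qed.

Lemma norm_rot2 c s (y : R * R) : c ^+ 2 + s ^+ 2 = 1 ->
  (rot2 c s y).1 ^+ 2 + (rot2 c s y).2 ^+ 2 = y.1 ^+ 2 + y.2 ^+ 2.
Proof.
case: y => [y1 y2] cs; rewrite /rot2/=.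
by transitivity ((c ^+ 2 + s ^+ 2) * (y1 ^+ 2 + y2 ^+ 2)); [ring|rewrite cs mul1r].
Qed.

Lemma cutoff_rot2 c s a b N : c ^+ 2 + s ^+ 2 = 1 ->
  rot2 c s @^-1` (cutoff (rot2 c s a) (rot2 c s b) N) = cutoff a b N.
Proof.
move=> cs; apply/seteqP; split => y; rewrite /cutoff/disc/= conic_rot2// norm_rot2//.
Qed.

Lemma sector_covers_rot2 c s a b N S : c ^+ 2 + s ^+ 2 = 1 ->
  sector_covers (rot2 c s a) (rot2 c s b) N S ->
  sector_covers a b N (rot2 c s @^-1` S).
Proof.
move=> cs [mS Sd Sk SA]; have [mr pr] := area_rot2 cs; split.
- exact: measurable_preimage.
- by move=> y /= /Sd; rewrite /disc/= norm_rot2.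
- move=> y /= /Sk[k [k0 kn kc]]; exists k.
  have E : (k * (rot2 c s y).1, k * (rot2 c s y).2) = rot2 c s (k * y.1, k * y.2).
    by rewrite /rot2/=; congr (_, _); ring.
  split => //.
    by rewrite -kn -(norm_rot2 (k * y.1, k * y.2) cs) -E.
  by move: kc; rewrite E conic_rot2.
- by rewrite pr// -(cutoff_rot2 _ _ _ cs) pr//; exact: measurable_cutoff.
Qed.

(** The conic is concave along the ray, positive at the origin and nonpositive
    at y. *)
Lemma conic_neg_beyond a b N (y : R * R) (k : R) : 0 < N -> 1 < k ->
  conic a b N y <= 0 -> conic a b N (k * y.1, k * y.2) < 0.
Proof.
move=> N0 k1; rewrite /conic/=.
set u := y.1 * a.1 + y.2 * a.2; set v := y.1 * b.1 + y.2 * b.2 => h.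
rewrite (_ : _ - _ = k * (N - 2 * u - v ^+ 2) - (k - 1) * N - k * (k - 1) * v ^+ 2); last first.
  by rewrite /u /v; ring.
have : k * (N - 2 * u - v ^+ 2) <= 0 by rewrite pmulr_rle0//; exact: lt_trans k1.
have : 0 < (k - 1) * N by rewrite mulr_gt0// subr_gt0.
have : 0 <= k * (k - 1) * v ^+ 2.
  by apply: mulr_ge0; [apply: mulr_ge0; lra|exact: sqr_ge0].
lra.
Qed.

(** Coordinates in which a is vertical. *)
Section vertical.
Variables (A N : R) (b : R * R).
Hypothesis A2 : 2 <= A.
Hypothesis AN : A ^+ 2 <= N.
Hypothesis b_eq : A ^+ 2 * b.2 ^+ 2 = (N - A ^+ 2) * (1 - b.1 ^+ 2 - b.2 ^+ 2).
Hypothesis b_le1 : b.1 ^+ 2 + b.2 ^+ 2 <= 1.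
Hypothesis unit_out : forall y : R * R, y.1 ^+ 2 + y.2 ^+ 2 = 1 -> 0 <= conic (0, A) b N y.

(** Among the lines whose point nearest to the origin has horizontal distance A,
    the horizontal line perpendicular to a cuts off the largest region.  Indeed
    N b.2^2 = (N - A^2) (1 - b.1^2), so by Cauchy-Schwarz
    (y . b)^2 <= y.1^2 + y.2^2 (N - A^2) / N, and y.2^2 <= N. *)
Lemma vertical_cutoff (y : R * R) : y.1 ^+ 2 + y.2 ^+ 2 <= rho ^+ 2 ->
  conic (0, A) b N y <= 0 -> A ^+ 2 <= 2 * A * y.2 + y.1 ^+ 2.
Proof.
case: y => [x y]; rewrite sqr_rho /conic/= mulr0 add0r => xy h.
have N4 : 4 <= A ^+ 2 by have := A2; nra.
have N0 : 0 < N by have := AN; lra.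
have be : N * b.2 ^+ 2 = (N - A ^+ 2) * (1 - b.1 ^+ 2).
  by have := b_eq; lra.
have CS : N * (x * b.1 + y * b.2) ^+ 2 <= N * x ^+ 2 + (N - A ^+ 2) * y ^+ 2.
  set B := b.1 in be *; set C := b.2 in be *; set D := N - A ^+ 2 in be *.
  have D0 : 0 <= D by rewrite subr_ge0.
  have B1 : 0 <= 1 - B ^+ 2 by have := b_le1; have := sqr_ge0 C; rewrite -/B -/C; lra.
  (* D times the difference of both sides is the square of N C x - D B y *)
  have [D00|Dn0] := eqVneq D 0.
    have C0 : C = 0.
      by apply/eqP; rewrite -sqrf_eq0 -(mulrI_eq0 _ (lregP (lt0r_neq0 N0))) be D00 mul0r.
    rewrite C0 D00 mulr0 addr0 mul0r addr0 exprMn ler_pM2l// ler_piMr ?sqr_ge0//; lra.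
  have Dp : 0 < D by rewrite lt0r Dn0.
  have e1 : D * (1 - B ^+ 2) = N * C ^+ 2 by rewrite be.
  have : 0 <= (N * C * x - D * B * y) ^+ 2 by exact: sqr_ge0.
  have -> : (N * C * x - D * B * y) ^+ 2 = N * x ^+ 2 * (N * C ^+ 2) - 2 * N * D * B * C * x * y +
     D ^+ 2 * y ^+ 2 * B ^+ 2 by ring.
  rewrite -e1 => sq; rewrite -(ler_pM2l Dp) -subr_ge0.
  rewrite (_ : _ - _ = N * x ^+ 2 * (D * (1 - B ^+ 2)) - 2 * N * D * B * C * x * y +
     D ^+ 2 * y ^+ 2 - D * y ^+ 2 * (N * C ^+ 2)); last by ring.
  by rewrite -e1; lra.
have z0 : 0 <= N - A ^+ 2 by rewrite subr_ge0.
have Nx : (N - A ^+ 2) * y ^+ 2 <= (N - A ^+ 2) * N.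
  by apply: ler_wpM2l => //; have := sqr_ge0 x; have := AN; lra.
have : N * (x * b.1 + y * b.2) ^+ 2 <= N * (x ^+ 2 + (N - A ^+ 2)) by lra.
by rewrite ler_pM2l//; lra.
Qed.


Let pi0 := @pi_gt0 R.
Let N0 : 0 < N.
Proof. by apply: lt_le_trans AN; rewrite exprn_gt0//; exact: lt_le_trans A2. Qed.

(** Angles are measured from the vertical axis. *)
Definition arc (t : R) : R * R := (rho * sin t, rho * cos t).

Lemma norm_arc t : (arc t).1 ^+ 2 + (arc t).2 ^+ 2 = rho ^+ 2.
Proof. by rewrite /arc/= !exprMn -mulrDr addrC cos2Dsin2 mulr1. Qed.

Lemma rot2_arc g t : rot2 (cos g) (sin g) (arc (g + t)) = arc t.
Proof.
rewrite /rot2/arc/= sinD cosD; have cs := cos2Dsin2 g.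
congr (_, _).
  transitivity (rho * ((cos g ^+ 2 + sin g ^+ 2) * sin t)); first by ring.
  by rewrite cs mul1r.
transitivity (rho * ((cos g ^+ 2 + sin g ^+ 2) * cos t)); first by ring.
by rewrite cs mul1r.
Qed.

(** On the circle [vertical_cutoff] reads (A - y.2)^2 <= rho^2.  Hence
    y.2 >= 2 - rho, which exceeds rho / sqrt 2. *)
Lemma cutoff_height (y : R * R) : y.1 ^+ 2 + y.2 ^+ 2 = rho ^+ 2 ->
  conic (0, A) b N y <= 0 -> rho * cos (pi / 4) < y.2.
Proof.
move=> yr yc; have := vertical_cutoff _ yc; rewrite yr lexx => /(_ isT).
have [rb r2] := (@rho_bounds R, @sqr_rho R); case/andP: rb => r1 r43.
rewrite cos_pi4 => h; rewrite sqr_rho in yr.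
have s0 : 0 < Num.sqrt 2 :> R by rewrite sqrtr_gt0.
have s2 : Num.sqrt 2 ^+ 2 = 2 :> R by rewrite sqr_sqrtr.
have h1 : (A - y.2) ^+ 2 <= rho ^+ 2 by rewrite r2; lra.
have r4 : rho < 116 / 100 :> R by nra.
have h2 : A - y.2 <= rho by rewrite leNgt; apply/negP => h3; nra.
have v0 : Num.sqrt 2 / 2 * 116 / 100 < 84 / 100 :> R by nra.
have : rho * (Num.sqrt 2 / 2) < 84 / 100 by nra.
by have := A2; lra.
Qed.

Lemma arc_ends t : cos t = cos (pi / 4) -> 0 < conic (0, A) b N (arc t).
Proof.
move=> tE; rewrite ltNge; apply/negP => /(cutoff_height (norm_arc t)).
by rewrite /arc/= tE ltxx.
Qed.

Lemma cutoff_arc (y : R * R) : cutoff (0, A) b N y ->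
  exists2 t, - (pi / 4) < t < pi / 4 & conic (0, A) b N (arc t) < 0.
Proof.
case: y => y1 y2 [/=]; rewrite /disc/= => yr yc.
pose n := Num.sqrt (y1 ^+ 2 + y2 ^+ 2).
have n2 : n ^+ 2 = y1 ^+ 2 + y2 ^+ 2 by rewrite sqr_sqrtr ?addr_ge0 ?sqr_ge0.
have r0 := @rho_gt0 R.
have n0 : 0 < n.
  rewrite sqrtr_gt0 lt0r addr_ge0 ?sqr_ge0// andbT paddr_eq0 ?sqr_ge0// !sqrf_eq0.
  apply/negP => /andP[/eqP y10 /eqP y20]; move: yc.
  by rewrite y10 y20 /conic/= !mul0r !addr0 mulr0 subr0 expr0n subr0 leNgt N0.
have nr : n < rho by rewrite -ltr_sqr ?nnegrE ?ltW// n2.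
pose k := rho / n.
have k1 : 1 < k by rewrite ltr_pdivlMr// mul1r.
have kneg := conic_neg_beyond N0 k1 yc.
have kn : (k * y1) ^+ 2 + (k * y2) ^+ 2 = rho ^+ 2.
  transitivity ((k * n) ^+ 2); first by rewrite [RHS]exprMn n2; ring.
  by rewrite /k divfK// gt_eqF.
have /= hk := cutoff_height (y := (k * y1, k * y2)) kn (ltW kneg).
rewrite /= in kneg.
move: (k * y1) (k * y2) kn kneg hk => w1 w2 kn kneg hk.
have c4 : 0 < cos (pi / 4) :> R by rewrite cos_pi4 divr_gt0// sqrtr_gt0.
have w20 : 0 < w2 by apply: lt_trans hk; rewrite mulr_gt0.
have wr : -1 <= w1 / rho <= 1.
  rewrite ler_pdivlMr// ler_pdivrMr// mulN1r mul1r -ler_norml.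
  rewrite -ler_sqr ?nnegrE ?(ltW r0)// real_normK ?num_real//.
  by rewrite -kn lerDl sqr_ge0.
pose t := asin (w1 / rho).
have st : rho * sin t = w1 by rewrite /t asinK ?in_itv//= mulrC divfK// gt_eqF.
have ct : rho * cos t = w2.
  apply/eqP; rewrite -(@eqrXn2 _ 2) ?(ltW w20)//; last first.
    by rewrite mulr_ge0 ?(ltW r0)// /t cos_asin// sqrtr_ge0.
  by apply/eqP; rewrite exprMn cos2sin2 mulrBr mulr1 -exprMn st -kn; ring.
have tE : arc t = (w1, w2) by rewrite /arc st ct.
exists t; last by rewrite tE.
rewrite -ltr_norml -ltr_cos ?in_itv/=.
- by rewrite cos_norm -(ltr_pM2l r0) ct.
- rewrite normr_ge0/= ler_norml; have := asin_geNpi2 wr; have := asin_lepi2 wr.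
  by rewrite -/t; have := pi0; lra.
- by have := pi0; lra.
Qed.

Lemma continuous_conic_arc : continuous (fun t => conic (0, A) b N (arc t)).
Proof.
by apply: is_derive_continuous => t; rewrite /conic/arc/=; apply: is_derive_eq.
Qed.

(** The conic is positive at both ends of the quarter circle and negative
    somewhere in between, so it vanishes at two angles ta < tb.  Rotating the mean of ta and tb
    to the vertical leads to the coordinates of the chord; the unit circle
    condition at the rotated top gives the parabolic segment. *)
Lemma vertical_sector : cutoff (0, A) b N !=set0 ->
  exists S, sector_covers (0, A) b N S.
Proof.
move=> [y /cutoff_arc[t /andP[t1 t2] ct]].
pose F t := conic (0, A) b N (arc t).
have cF (u v : R) : {within `[u, v], continuous F}.
  by apply: continuous_subspaceT; exact: continuous_conic_arc.
have FN : 0 < F (- (pi / 4)) by apply: arc_ends; rewrite cosN.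
have FP : 0 < F (pi / 4) by exact: arc_ends.
have ct0 : F t <= 0 := ltW ct.
have [|ta] := IVT (v := 0) (ltW t1) (cF _ _).
  by rewrite ge_min le_max ct0 (ltW FN) orbT.
rewrite in_itv/= => /andP[ta1 ta2] Fa.
have [|tb] := IVT (v := 0) (ltW t2) (cF _ _).
  by rewrite ge_min le_max ct0 (ltW FP) orbT.
rewrite in_itv/= => /andP[tb1 tb2] Fb.
have {}ta1 : - (pi / 4) < ta.
  by rewrite lt_neqAle ta1 andbT; apply/eqP => e; rewrite e Fa ltxx in FN.
have {}ta2 : ta < t.
  by rewrite lt_neqAle ta2 andbT; apply/eqP => e; rewrite -e -/(F _) Fa ltxx in ct.
have {}tb1 : t < tb.
  by rewrite lt_neqAle tb1 andbT; apply/eqP => e; rewrite e -/(F _) Fb ltxx in ct.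
have {}tb2 : tb < pi / 4.
  by rewrite lt_neqAle tb2 andbT; apply/eqP => e; rewrite -e Fb ltxx in FP.
pose th := (tb - ta) / 2; pose g := (ta + tb) / 2.
have th_range : 0 < th < pi / 4 by rewrite /th; lra.
have gE : g - th = ta /\ g + th = tb by rewrite /g /th; split; lra.
have cs := cos2Dsin2 g.
have cg : cos (pi / 4) < cos g.
  rewrite -[ltRHS]cos_norm ltr_cos ?in_itv/=.
  - by rewrite /g ltr_norml; lra.
  - by rewrite normr_ge0/= /g ler_norml; have := pi0; lra.
  - by have := pi0; lra.
have rE : (- (rho * sin th), rho * cos th) = arc (- th).
  by rewrite /arc sinN cosN mulrN.
exists (rot2 (cos g) (sin g) @^-1` sector rho th).
apply: sector_covers_rot2 => //.
have chl : conic (rot2 (cos g) (sin g) (0, A)) (rot2 (cos g) (sin g) b) N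
    (- (rho * sin th), rho * cos th) = 0.
  by rewrite rE -(rot2_arc g (- th)) conic_rot2// gE.1.
have chr : conic (rot2 (cos g) (sin g) (0, A)) (rot2 (cos g) (sin g) b) N
    (rho * sin th, rho * cos th) = 0.
  by rewrite -/(arc th) -(rot2_arc g th) conic_rot2// gE.2.
have top : 0 <= conic (rot2 (cos g) (sin g) (0, A)) (rot2 (cos g) (sin g) b) N (0, 1).
  have -> : (0, 1) = rot2 (cos g) (sin g) (sin g, cos g).
    by rewrite /rot2/=; congr (_, _); [ring|rewrite -cs; ring].
  by rewrite conic_rot2//; apply: unit_out; rewrite /= addrC.
have bl : (rot2 (cos g) (sin g) b).1 ^+ 2 + (rot2 (cos g) (sin g) b).2 ^+ 2 <= 1.
  by rewrite norm_rot2.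
have al : rho < (rot2 (cos g) (sin g) (0, A)).2.
  rewrite /rot2/= mulr0 add0r.
  have r43 : rho < 4 / 3 by have /andP[] := @rho_bounds R.
  have : 2 / 3 < cos g.
    apply: lt_trans cg; rewrite cos_pi4.
    have : 0 < Num.sqrt 2 :> R by rewrite sqrtr_gt0.
    have : Num.sqrt 2 ^+ 2 = 2 :> R by rewrite sqr_sqrtr.
    nra.
  have := A2; nra.
split.
- exact: measurable_sector.
- by move=> z [].
- by move=> z; exact: sector_reaches_cutoff.
- exact: cutoff_area_le_sector.
Qed.

End vertical.

(** The equation for a . b expresses that z is orthogonal to v, with the vertical
    parts of both eliminated. *)
Lemma conic_sector a b N :
  4 <= a.1 ^+ 2 + a.2 ^+ 2 <= N ->
  b.1 ^+ 2 + b.2 ^+ 2 <= 1 ->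
  (a.1 * b.1 + a.2 * b.2) ^+ 2 =
    (N - a.1 ^+ 2 - a.2 ^+ 2) * (1 - b.1 ^+ 2 - b.2 ^+ 2) ->
  (forall y : R * R, y.1 ^+ 2 + y.2 ^+ 2 = 1 -> 0 <= conic a b N y) ->
  cutoff a b N !=set0 ->
  exists S, sector_covers a b N S.
Proof.
move=> /andP[a4 aN] b1 ab out [y yK].
pose A := Num.sqrt (a.1 ^+ 2 + a.2 ^+ 2).
have A2 : A ^+ 2 = a.1 ^+ 2 + a.2 ^+ 2 by rewrite sqr_sqrtr ?addr_ge0 ?sqr_ge0.
have A0 : 0 <= A by exact: sqrtr_ge0.
have A2' : 2 <= A by rewrite -ler_sqr ?nnegrE// A2; lra.
have An0 : A != 0 by rewrite gt_eqF//; lra.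
have cs : (a.2 / A) ^+ 2 + (a.1 / A) ^+ 2 = 1.
  by rewrite !expr_div_n -mulrDl addrC -A2 divff// expf_neq0.
have aE : rot2 (a.2 / A) (a.1 / A) a = (0, A).
  rewrite /rot2; congr (_, _); first by field.
  transitivity (A ^+ 2 / A); last by rewrite expr2 mulfK.
  by rewrite A2; ring.
set b' := rot2 (a.2 / A) (a.1 / A) b.
have nb : b'.1 ^+ 2 + b'.2 ^+ 2 = b.1 ^+ 2 + b.2 ^+ 2 by exact: norm_rot2.
have b2E : A * b'.2 = a.1 * b.1 + a.2 * b.2.
  by rewrite /b'/rot2/=; field.
have [|||||S SP] := @vertical_sector A N b' A2' _ _ _ _ _.
- by rewrite A2.
- by rewrite -exprMn b2E ab A2 -!addrA -!opprD nb.
- by rewrite nb.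
- move=> z z1.
  have cs' : (a.2 / A) ^+ 2 + (- (a.1 / A)) ^+ 2 = 1 by rewrite sqrrN.
  have zE : z = rot2 (a.2 / A) (a.1 / A) (rot2 (a.2 / A) (- (a.1 / A)) z).
    case: z {z1} => z1 z2; rewrite /rot2/=; congr (_, _).
      transitivity (((a.2 / A) ^+ 2 + (a.1 / A) ^+ 2) * z1); last by ring.
      by rewrite cs mul1r.
    transitivity (((a.2 / A) ^+ 2 + (a.1 / A) ^+ 2) * z2); last by ring.
    by rewrite cs mul1r.
  by rewrite zE -aE conic_rot2//; apply: out; rewrite norm_rot2.
- have := yK; rewrite -(cutoff_rot2 a b N cs) aE => yK'.
  by exists (rot2 (a.2 / A) (a.1 / A) y).
by exists (rot2 (a.2 / A) (a.1 / A) @^-1` S); apply: sector_covers_rot2; rewrite ?aE.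
Qed.

End sector_cover.


(** * Finite unions *)
Section finite_families.
Context d (X : measurableType d) (R : realType) (mu : {measure set X -> \bar R}).
Variable T : eqType.
Implicit Types (s : seq T) (F : T -> set X).

Definition union_seq s F : set X := [set x | exists2 j, j \in s & F j x].

Lemma union_seq_cons j s F : union_seq (j :: s) F = F j `|` union_seq s F.
Proof.
apply/seteqP; split => x.
  by move=> [k]; rewrite inE => /predU1P[->|ks] Fx; [left|right; exists k].
move=> [Fx|[k ks Fx]]; first by exists j; rewrite ?mem_head.
by exists k => //; rewrite inE ks orbT.
Qed.

Lemma measurable_union_seq s F : (forall j, j \in s -> measurable (F j)) ->
  measurable (union_seq s F).
Proof.
elim: s => [|j s IH] mF.
  by rewrite (_ : union_seq _ _ = set0)//; apply/seteqP; split => x // -[].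
rewrite union_seq_cons; apply: measurableU; first by apply: mF; rewrite mem_head.
by apply: IH => k ks; apply: mF; rewrite inE ks orbT.
Qed.

Lemma measure_union_seq_le s F : (forall j, j \in s -> measurable (F j)) ->
  (mu (union_seq s F) <= \sum_(j <- s) mu (F j))%E.
Proof.
elim: s => [|j s IH] mF.
  rewrite (_ : union_seq _ _ = set0) ?measure0 ?big_nil//.
  by apply/seteqP; split => x // -[].
have mFs k : k \in s -> measurable (F k) by move=> ks; apply: mF; rewrite inE ks orbT.
rewrite union_seq_cons big_cons; apply: le_trans (leeD2l _ (IH mFs)).
apply: measureU2; [by apply: mF; rewrite mem_head|exact: measurable_union_seq].
Qed.

Lemma sum_measure_le s F (E : set X) : uniq s -> measurable E ->
  (forall j, j \in s -> measurable (F j)) ->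
  (forall j k x, j \in s -> k \in s -> j != k -> F j x -> F k x -> False) ->
  (forall j, j \in s -> F j `<=` E) ->
  (\sum_(j <- s) mu (F j) <= mu E)%E.
Proof.
elim: s E => [|j s IH] E; first by rewrite big_nil.
move=> /= /andP[js us] mE mF dF FE.
have mFj : measurable (F j) by apply: mF; rewrite mem_head.
have FjE : F j `<=` E by apply: FE; rewrite mem_head.
have inS k : k \in s -> k \in j :: s by rewrite inE orbC => ->.
have -> : mu E = (mu (F j) + mu (E `\` F j))%E.
  rewrite -measureU//=; last 2 first.
  - exact: measurableD.
  - by rewrite setDE setICA setICr setI0.
  by rewrite setDUK.
rewrite big_cons leeD2l//; apply: IH => //.
- exact: measurableD.
- by move=> k /inS; exact: mF.
- by move=> k l x /inS kS /inS lS; exact: dF.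
- move=> k ks x Fk; split; first exact: FE (inS _ ks) _ Fk.
  apply: (dF k j) => //; [exact: inS|exact: mem_head|].
  by apply/eqP => kj; rewrite -kj ks in js.
Qed.

End finite_families.

(** * The area left by several lines *)
Section slice.
Context {R : realType}.
Local Notation rho := (@rho R).
Local Notation kappa := (@kappa R).
Implicit Types (z v p q : space3 R) (y : R * R).

(** The squared Euclidean norm. *)
Definition sq3 p : R := dot3 p p.

Lemma sq3_ge0 p : 0 <= sq3 p.
Proof. by rewrite /sq3/dot3 !addr_ge0// -expr2 sqr_ge0. Qed.

Lemma parallelogram3 p q : sq3 (p + q) + sq3 (p - q) = 2 * (sq3 p + sq3 q).
Proof. by case: p q => [[p1 p2] p3] [[q1 q2] q3]; rewrite /sq3/dot3/=; ring. Qed.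

Definition line_cutoff z v : set (R * R) := cutoff z.1 v.1 (sq3 z).

Lemma sq3_line_conic z v y (k : R) : dot3 v v = 1 -> dot3 z v = 0 ->
  sq3 ((y, 0) - (z + k *: v)) =
  y.1 ^+ 2 + y.2 ^+ 2 + conic z.1 v.1 (sq3 z) y + (k - (y.1 * v.1.1 + y.2 * v.1.2)) ^+ 2.
Proof.
case: z v y => [[z1 z2] z3] [[v1 v2] v3] [y1 y2]; rewrite /sq3/dot3/conic/= => v1E zv.
rewrite /GRing.scale/=.
transitivity ((y1 - z1) ^+ 2 + (y2 - z2) ^+ 2 + z3 ^+ 2 + k ^+ 2 * (v1 * v1 + v2 * v2 + v3 * v3)
  + 2 * k * (z1 * v1 + z2 * v2 + z3 * v3) - 2 * k * (y1 * v1 + y2 * v2)); first by ring.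
by rewrite v1E zv; ring.
Qed.

Lemma sq3_line z v (k : R) : dot3 v v = 1 -> dot3 z v = 0 ->
  sq3 (z + k *: v) = sq3 z + k ^+ 2.
Proof.
case: z v => [[z1 z2] z3] [[v1 v2] v3]; rewrite /sq3/dot3/= => v1E zv.
rewrite /GRing.scale/=.
transitivity (z1 * z1 + z2 * z2 + z3 * z3 + k ^+ 2 * (v1 * v1 + v2 * v2 + v3 * v3)
  + 2 * k * (z1 * v1 + z2 * v2 + z3 * v3)); first by ring.
by rewrite v1E zv; ring.
Qed.

(** The point of the line that is nearest to (y, 0). *)
Definition foot z v y : space3 R := z + (y.1 * v.1.1 + y.2 * v.1.2) *: v.

Lemma sq3_foot z v y : dot3 v v = 1 -> dot3 z v = 0 ->
  sq3 ((y, 0) - foot z v y) = y.1 ^+ 2 + y.2 ^+ 2 + conic z.1 v.1 (sq3 z) y.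
Proof. by move=> v1 zv; rewrite sq3_line_conic// subrr expr0n addr0. Qed.

(** If the foot is as close to (y, 0) as the origin is, it lies within 2 |y| of
    the origin. *)
Lemma sq3_foot_lt z v y (r : R) : dot3 v v = 1 -> dot3 z v = 0 ->
  y.1 ^+ 2 + y.2 ^+ 2 < r \/ y.1 ^+ 2 + y.2 ^+ 2 <= r /\ conic z.1 v.1 (sq3 z) y < 0 ->
  conic z.1 v.1 (sq3 z) y <= 0 ->
  sq3 (foot z v y) < 4 * r.
Proof.
move=> v1 zv yr yc.
have := parallelogram3 ((y, 0) - foot z v y) (y, 0).
rewrite (sq3_foot y v1 zv).
have -> : sq3 ((y, 0) - foot z v y - (y, 0)) = sq3 (foot z v y).
  by case: (foot z v y) => [[f1 f2] f3]; rewrite /sq3/dot3/=; ring.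
have -> : sq3 (y, 0) = y.1 ^+ 2 + y.2 ^+ 2 by rewrite /sq3/dot3/=; ring.
by have := sq3_ge0 ((y, 0) - foot z v y + (y, 0)); case: yr; lra.
Qed.

(** Lines that are far from the vertical axis and from each other, but only
    inside the ball of radius 2 rho, whose squared radius is 16 / 3: outside of it
    the lines need no longer be covered by the segments. *)
Section packing_slice.
Variables (T : eqType) (s : seq T) (z v : T -> space3 R).
Hypothesis us : uniq s.
Hypothesis v1 : forall j, j \in s -> dot3 (v j) (v j) = 1.
Hypothesis zv : forall j, j \in s -> dot3 (z j) (v j) = 0.
Hypothesis axis_far : forall j k, j \in s -> sq3 (z j + k *: v j) < 16 / 3 ->
  4 <= (z j + k *: v j).1.1 ^+ 2 + (z j + k *: v j).1.2 ^+ 2.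
Hypothesis lines_far : forall i j k l, i \in s -> j \in s -> i != j ->
  sq3 (z i + k *: v i) < 16 / 3 -> sq3 (z j + l *: v j) < 16 / 3 ->
  4 <= sq3 (z i + k *: v i - (z j + l *: v j)).

(** A point of the unit circle whose foot were closer than 1 would have that foot
    inside the ball of radius 2, too close to the axis. *)
Lemma line_sector j : j \in s -> exists S, sector_covers (z j).1 (v j).1 (sq3 (z j)) S.
Proof.
move=> js; have [vj zj] := (v1 js, zv js).
have [K0|/set0P[y yK]] := eqVneq (line_cutoff (z j) (v j)) set0.
  exists set0; split => //.
  by rewrite -/(line_cutoff (z j) (v j)) K0 !measure0 mule0.
have r2 := @sqr_rho R.
have zlt : sq3 (z j) < 16 / 3.
  case: yK => yd yc.
  have := @sq3_foot_lt (z j) (v j) y (4 / 3) vj zj.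
  rewrite -r2 => /(_ (or_introl yd) yc).
  rewrite /foot sq3_line//; have := sqr_ge0 (y.1 * (v j).1.1 + y.2 * (v j).1.2).
  by rewrite r2; lra.
have a4 := axis_far (k := 0) js; rewrite scale0r addr0 in a4.
have zE : sq3 (z j) = (z j).1.1 ^+ 2 + (z j).1.2 ^+ 2 + (z j).2 ^+ 2.
  by rewrite /sq3/dot3; ring.
have vE : (v j).1.1 ^+ 2 + (v j).1.2 ^+ 2 + (v j).2 ^+ 2 = 1 by rewrite -vj /dot3; ring.
apply: conic_sector => //; last by exists y.
- by rewrite a4//= zE lerDl sqr_ge0.
- by rewrite -vE lerDl sqr_ge0.
- have e : (z j).1.1 * (v j).1.1 + (z j).1.2 * (v j).1.2 = - ((z j).2 * (v j).2).
    by apply/eqP; rewrite -addr_eq0 -/(dot3 _ _) zj.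
  rewrite e zE -vE; ring.
- move=> w w1; rewrite leNgt; apply/negP => wc.
  have := @sq3_foot_lt (z j) (v j) w 1 vj zj (or_intror (conj _ wc)) (ltW wc).
  rewrite w1 lexx => /(_ isT) h.
  have : sq3 (foot (z j) (v j) w) < 16 / 3 by lra.
  move=> /(axis_far js) h2.
  have := sqr_ge0 (foot (z j) (v j) w).2; move: h h2; rewrite -/(foot _ _ _).
  by rewrite /sq3/dot3 -!expr2; lra.
Qed.

(** A common ray reaches the circle at a point w with two feet closer than rho.
    The origin and the feet are three points with mutual distances at least 2, so
    by Lagrange's identity their squared distances from w add up to at least
    4 = 3 rho^2. *)
Lemma sectors_disjoint S i j y : i \in s -> j \in s -> i != j ->
  (forall k, k \in s -> sector_covers (z k).1 (v k).1 (sq3 (z k)) (S k)) ->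
  S i y -> S j y -> False.
Proof.
move=> is_ js ij HS Si Sj.
have [_ _ /(_ y Si)[k [k0 kn kc]] _] := HS i is_.
have [_ _ /(_ y Sj)[l [l0 ln lc]] _] := HS j js.
have kn' : k ^+ 2 * (y.1 ^+ 2 + y.2 ^+ 2) = 4 / 3 by rewrite -sqr_rho -kn; ring.
have ln' : l ^+ 2 * (y.1 ^+ 2 + y.2 ^+ 2) = 4 / 3 by rewrite -sqr_rho -ln; ring.
have kl : k = l.
  have yn : (y.1 ^+ 2 + y.2 ^+ 2) != 0.
    by apply/eqP => y0; move: kn'; rewrite y0 mulr0; lra.
  apply/eqP; rewrite -(@eqrXn2 _ 2) ?(ltW k0) ?(ltW l0)//.
  by apply/eqP; apply: (mulIf yn); rewrite kn' ln'.
rewrite -kl in lc; clear l l0 ln ln' kl.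
move: (k * y.1) (k * y.2) kn kc lc => w1 w2 wn ic jc; set w := (w1, w2) in ic jc *.
have r2 := @sqr_rho R; rewrite r2 in wn.
have foot_in m : m \in s -> conic (z m).1 (v m).1 (sq3 (z m)) w < 0 ->
    sq3 (foot (z m) (v m) w) < 16 / 3 /\ 4 <= sq3 (foot (z m) (v m) w).
  move=> ms mc; have := sq3_foot_lt (v1 ms) (zv ms) (or_intror (conj (lexx _) mc)) (ltW mc).
  rewrite wn => h; have h' : sq3 (foot (z m) (v m) w) < 16 / 3 by lra.
  split => //; apply: le_trans (axis_far ms h') _.
  by have := sqr_ge0 (foot (z m) (v m) w).2; rewrite /sq3/dot3 -!expr2 -/(foot _ _ _); lra.
have [fi1 fi2] := foot_in _ is_ ic; have [fj1 fj2] := foot_in _ js jc.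
have ff := lines_far is_ js ij fi1 fj1.
have di := sq3_foot w (v1 is_) (zv is_); have dj := sq3_foot w (v1 js) (zv js).
rewrite /= wn in di dj.
rewrite -!/(foot _ _ _) in ff.
move: (foot (z i) (v i) w) (foot (z j) (v j) w) fi2 fj2 ff di dj => p q p4 q4 pq wp wq.
have Lag : sq3 p + sq3 q + sq3 (p - q) + sq3 ((w, 0) + ((w, 0) - p) + ((w, 0) - q)) =
  3 * (sq3 (w, 0) + sq3 ((w, 0) - p) + sq3 ((w, 0) - q)).
  by case: p q {p4 q4 pq wp wq} => [[p1 p2] p3] [[q1 q2] q3]; rewrite /sq3/dot3/=; ring.
have wE : sq3 (w, 0) = 4 / 3 by rewrite -wn /sq3/dot3/=; ring.
have := sq3_ge0 ((w, 0) + ((w, 0) - p) + ((w, 0) - q)); lra.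
Qed.

(** The cut-off regions occupy at most the fraction [kappa] of disjoint subsets
    of the disc, hence of the disc, and (1 - kappa) pi rho^2 = 2 sqrt 3. *)
Lemma packing_slice :
  ((2 * Num.sqrt 3)%:E <=
   area R (disc rho `\` union_seq s (fun j => line_cutoff (z j) (v j))))%E.
Proof.
have [S HS] : exists S, forall k, k \in s -> sector_covers (z k).1 (v k).1 (sq3 (z k)) (S k).
  have /choice[S HS] : forall k, exists S, k \in s -> sector_covers (z k).1 (v k).1 (sq3 (z k)) S.
    move=> k; have [ks|ks] := boolP (k \in s); last by exists set0.
    by have [S ?] := line_sector ks; exists S.
  by exists S.
set F := fun j => line_cutoff (z j) (v j).
have mF j : j \in s -> measurable (F j) by move=> _; exact: measurable_cutoff.
have r0 := @rho_gt0 R; have pi0 := @pi_gt0 R.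
have mD := measurable_disc rho.
have dD := area_disc r0.
have FD : union_seq s F `<=` disc rho by move=> y [j _ []].
have sumS : (\sum_(j <- s) area R (S j) <= area R (disc rho))%E.
  apply: sum_measure_le => //.
  - by move=> j /HS[].
  - by move=> i j y is_ js ij; exact: (sectors_disjoint is_ js ij HS).
  - by move=> j /HS[].
have areaF : (area R (union_seq s F) <= kappa%:E * area R (disc rho))%E.
  apply: (le_trans (measure_union_seq_le (area R) mF)).
  apply: (le_trans _ (lee_wpmul2l _ sumS)); last by rewrite lee_fin kappa_ge0.
  rewrite ge0_sume_distrr; last by move=> j _; exact: measure_ge0.
  rewrite big_seq [leRHS]big_seq; apply: lee_sum => j /HS[_ _ _]; exact.
have : area R (disc rho) = (area R (union_seq s F) + area R (disc rho `\` union_seq s F))%E.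
  rewrite -measureU//=; last 3 first.
  - exact: measurable_union_seq.
  - by apply: measurableD => //; exact: measurable_union_seq.
  - by rewrite setDE setICA setICr setI0.
  by rewrite setDUK.
rewrite dD sqr_rho in areaF *.
rewrite -EFinM in areaF.
move: (area R _) (area R _) areaF => [x| |] [y| |]//=.
  rewrite -EFinD !lee_fin => h [e].
  suff : 2 * Num.sqrt 3 = (1 - kappa) * (pi * (4 / 3)) by lra.
  by rewrite /kappa; move: (@pi R) pi0 => p p0; field; exact: lt0r_neq0.
Qed.

End packing_slice.
End slice.


(** * Volumes from sections *)
Section volumes.
Context {R : realType}.
Implicit Types (A : set (space3 R)) (D : set R) (q r k : R).

Lemma area_open_disc q : 0 <= q ->
  area R [set y | y.1 ^+ 2 + y.2 ^+ 2 < q] = (pi * q)%:E.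
Proof.
rewrite le_eqVlt => /predU1P[<-|q0].
  rewrite mulr0 (_ : [set y | _] = set0) ?measure0//.
  by apply/seteqP; split => y //=; rewrite ltNge addr_ge0 ?sqr_ge0.
have := @area_disc R (Num.sqrt q); rewrite sqrtr_gt0 => /(_ q0).
by rewrite /disc sqr_sqrtr// ltW.
Qed.

(** By comparison with larger open discs, which includes the case q = 0. *)
Lemma area_closed_disc_le q : 0 <= q ->
  (area R [set y | (y.1 ^+ 2 + y.2 ^+ 2 <= q)%R] <= (pi * q)%:E)%E.
Proof.
move=> q0; apply/lee_addgt0Pr => e e0.
have pi0 := @pi_gt0 R.
have e1 : 0 < e / pi by rewrite divr_gt0.
have -> : ((pi * q)%:E + e%:E = (pi * (q + e / pi))%:E)%E.
  by rewrite -EFinD mulrDr mulrC (mulrCA pi) divff ?mulr1 ?lt0r_neq0// mulrC.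
rewrite -area_open_disc; last by rewrite addr_ge0// ltW.
apply: le_measure; rewrite ?inE.
- by apply: measurable_le_set; mfun.
- by apply: measurable_lt_set; mfun.
- by move=> y /= yq; lra.
Qed.

Lemma measurable_sq3 : measurable_fun setT (@sq3 R).
Proof. by rewrite /sq3/dot3; mfun. Qed.

Lemma measurable_ball3 q : measurable [set p : space3 R | sq3 p <= q].
Proof. by apply: measurable_le_set; [exact: measurable_sq3|exact: measurable_cst]. Qed.

Lemma sq3E (x y z : R) : sq3 (x, y, z) = x ^+ 2 + y ^+ 2 + z ^+ 2.
Proof. by rewrite /sq3/dot3/= -!expr2. Qed.

Lemma ball_slice r z : [set y : R * R | sq3 (y, z) <= r ^+ 2] =
  [set y | y.1 ^+ 2 + y.2 ^+ 2 <= r ^+ 2 - z ^+ 2].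
Proof. by apply/seteqP; split => -[x y] /=; rewrite sq3E lerBrDr. Qed.

Lemma ball_slices_integral r : 0 <= r ->
  (\int[length R]_(z in `[(- r)%R, r]) (pi * (r ^+ 2 - (z - 0) ^+ 2))%:E)%E
    = (4 / 3 * pi * r ^+ 3)%:E.
Proof.
move=> r0; rewrite integral_ball_slices; last by lra.
by congr (_%:E); rewrite !subr0; field.
Qed.

Lemma volume_ball r : 0 <= r ->
  volume R [set p | sq3 p <= r ^+ 2] = (4 / 3 * pi * r ^+ 3)%:E.
Proof.
move=> r0; have mB := measurable_ball3 (r ^+ 2).
have mf : measurable_fun `[- r, r] (fun z : R => pi * (r ^+ 2 - (z - 0) ^+ 2)).
  by apply: measurable_funTS; apply: continuous_measurable_fun; exact: continuous_ball_slices.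
have zr (z : R) : z \in `[- r, r] -> 0 <= r ^+ 2 - (z - 0) ^+ 2.
  rewrite in_itv/= => /andP[? ?]; rewrite subr0; nra.
rewrite -(ball_slices_integral r0); apply/eqP; rewrite eq_le; apply/andP; split.
  apply: (@le_slices _ _ _ _ _ (area R) (length R)) => //.
  - move=> [x y] z /=; rewrite sq3E in_itv/= => h.
    by have := sqr_ge0 x; have := sqr_ge0 y => ? ?; apply/andP; split; nra.
  - move=> z zI; have := zr z zI; rewrite subr0 => z0.
    by apply: le_trans (area_closed_disc_le z0); rewrite /= ball_slice.
apply: (@ge_slices _ _ _ _ _ (area R) (length R)) => //.
- by move=> z zI; rewrite mulr_ge0 ?pi_ge0// zr.
- move=> z zI; have := zr z zI; rewrite subr0 => z0.
  rewrite -area_open_disc// [X in (_ <= _ X)%E]ball_slice.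
  apply: le_measure; rewrite ?inE.
  + by apply: measurable_lt_set; mfun.
  + by apply: measurable_le_set; mfun.
  + by move=> y /= /ltW.
Qed.

Lemma volume_ball_at (a : space3 R) r : 0 <= r ->
  volume R [set p | sq3 (p - a) <= r ^+ 2] = (4 / 3 * pi * r ^+ 3)%:E.
Proof.
move=> r0; rewrite -(volume_ball r0).
have [_ h] := volume_translate (- a); exact: (h _ (measurable_ball3 _)).
Qed.

Lemma volume_ge_const A D k : measurable A -> measurable D -> 0 <= k ->
  (forall z, D z -> (k%:E <= area R [set y | A (y, z)])%E) ->
  (k%:E * length R D <= volume R (A `&` [set p | D p.2]))%E.
Proof.
move=> mA mD k0 kA; rewrite -integral_cst//.
apply: (@ge_slices _ _ _ _ _ (area R) (length R)) => //.
- by apply: measurableI => //; exact: (measurable_preimage (f := snd)).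
- move=> z Dz; apply: le_trans (kA z Dz) _.
  rewrite le_eqVlt; apply/orP; left; apply/eqP; congr (area R _).
  by apply/seteqP; split => y //= [].
Qed.

Lemma volume_ge_cap A (c a b : R) : measurable A -> a <= b ->
  (forall z, a <= z <= b -> 0 <= 1 ^+ 2 - (z - c) ^+ 2) ->
  (forall z : R, (a <= z <= b)%R ->
    ((pi * (1 ^+ 2 - (z - c) ^+ 2))%:E <= area R [set y | A (y, z)])%E) ->
  ((pi * (1 ^+ 2 * (b - a) - ((b - c) ^+ 3 - (a - c) ^+ 3) / 3))%:E <=
    volume R (A `&` [set p : space3 R | (a <= p.2 <= b)%R]))%E.
Proof.
move=> mA ab z1 zA; rewrite -integral_ball_slices//.
apply: (@ge_slices _ _ _ _ _ (area R) (length R)) => //.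
- apply: measurableI => //.
  have : measurable (snd @^-1` `[a, b]%classic : set (space3 R)) by exact: measurable_preimage.
  by congr measurable; apply/seteqP; split => p /=; rewrite in_itv.
- by apply: measurable_funTS; apply: continuous_measurable_fun; exact: continuous_ball_slices.
- by move=> z /=; rewrite in_itv/= => /z1 ?; rewrite mulr_ge0 ?pi_ge0.
- move=> z /=; rewrite in_itv/= => zab; apply: le_trans (zA z zab) _.
  rewrite le_eqVlt; apply/orP; left; apply/eqP; congr (area R _).
  by apply/seteqP; split => y //= [].
Qed.

End volumes.


(** * Truncated Dirichlet cells of segments *)
Section segments.
Context {R : realType}.

Lemma sq3_triangle (p q1 q2 : space3 R) :
  sq3 (q1 - q2) <= 2 * (sq3 (p - q1) + sq3 (p - q2)).
Proof.
rewrite -parallelogram3 (_ : sq3 (q1 - q2) = sq3 (p - q1 - (p - q2))).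
  by rewrite lerDr sq3_ge0.
by case: p q1 q2 => [[p1 p2] p3] [[a1 a2] a3] [[b1 b2] b3]; rewrite /sq3/dot3/=; ring.
Qed.

Lemma convex_comb_lt (k X Y M : R) : 0 <= k <= 1 -> X < M -> Y < M ->
  k * X + (1 - k) * Y < M.
Proof.
move=> /andP[k0 k1] XM YM; rewrite -subr_gt0.
rewrite (_ : _ - _ = k * (M - X) + (1 - k) * (M - Y)); last by ring.
move: k0; rewrite le_eqVlt => /predU1P[<-|k0]; first by rewrite mul0r add0r subr0 mul1r subr_gt0.
by rewrite ltr_pwDl ?mulr_gt0 ?mulr_ge0 ?subr_ge0 ?subr_gt0// ltW.
Qed.

Variable tau : R.
Hypothesis tau0 : 0 < tau.
Implicit Types (p q P V : space3 R).

Definition clamp (k : R) : R := Num.max 0 (Num.min k tau).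

Lemma clamp_range k : 0 <= clamp k <= tau.
Proof. by rewrite /clamp le_max lexx/= ge_max (ltW tau0) ge_min lexx orbT. Qed.

Lemma clamp_id k : 0 <= k <= tau -> clamp k = k.
Proof. by move=> /andP[k0 kt]; rewrite /clamp min_l// max_r. Qed.

Lemma clamp_le0 k : k <= 0 -> clamp k = 0.
Proof. by move=> k0; rewrite /clamp max_l// ge_min k0. Qed.

Lemma clamp_ge k : tau <= k -> clamp k = tau.
Proof. by move=> k0; rewrite /clamp min_r// max_r// ltW. Qed.

(** The point nearest to p of the segment with origin P, direction V and
    length tau. *)
Definition seg_point P V p : space3 R := P + clamp (dot3 (p - P) V) *: V.

Definition seg_dist2 P V p : R := sq3 (p - seg_point P V p).

Lemma measurable_clamp : measurable_fun setT clamp.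
Proof.
by apply: measurable_maxr => //; apply: measurable_minr.
Qed.

Lemma measurable_seg_dist2 P V : measurable_fun setT (seg_dist2 P V).
Proof.
apply: (measurableT_comp measurable_sq3).
have md : measurable_fun setT (fun p => clamp (dot3 (p - P) V)).
  by apply: (measurableT_comp measurable_clamp); rewrite /dot3/=; mfun.
suff : measurable_fun setT (fun p : space3 R =>
  ((p.1.1 - (P.1.1 + clamp (dot3 (p - P) V) * V.1.1),
    p.1.2 - (P.1.2 + clamp (dot3 (p - P) V) * V.1.2)),
    p.2 - (P.2 + clamp (dot3 (p - P) V) * V.2))) by [].
by mfun.
Qed.

Section cells.
Variables (T : eqType) (s : seq T) (P V : T -> space3 R).

(** The bound 4 / 3 is the square of [rho]. *)
Definition cell i : set (space3 R) :=
  [set p | seg_dist2 (P i) (V i) p < 4 / 3] `&`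
  [set p | forall j, j \in s -> j != i -> seg_dist2 (P i) (V i) p < seg_dist2 (P j) (V j) p].

Lemma measurable_cell i : measurable (cell i).
Proof.
apply: measurableI.
  by apply: measurable_lt_set; [exact: measurable_seg_dist2|exact: measurable_cst].
have -> : [set p | forall j, j \in s -> j != i -> seg_dist2 (P i) (V i) p < seg_dist2 (P j) (V j) p]
  = ~` union_seq s (fun j => [set p | j != i /\
         seg_dist2 (P j) (V j) p <= seg_dist2 (P i) (V i) p]).
  apply/seteqP; split => p /=.
    by move=> h [j js [ji]]; rewrite leNgt h.
  by move=> h j js ji; rewrite ltNge; apply/negP => h'; apply: h; exists j.
apply: measurableC; apply: measurable_union_seq => j _.
case: (j == i); first by rewrite (_ : [set p | _] = set0)//; apply/seteqP; split => p // -[].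
rewrite (_ : [set p | _] = [set p | seg_dist2 (P j) (V j) p <= seg_dist2 (P i) (V i) p]).
  by apply: measurable_le_set; exact: measurable_seg_dist2.
by apply/seteqP; split => p //= [].
Qed.

Lemma cell_disjoint i j p : i \in s -> j \in s -> i != j ->
  cell i p -> cell j p -> False.
Proof.
move=> is_ js ij [_ /(_ j js)] + [_ /(_ i is_ ij)].
by rewrite eq_sym => /(_ ij) => h1 h2; have := lt_trans h1 h2; rewrite ltxx.
Qed.

End cells.

(** Coordinates in which segment i lies on the third axis and starts at the
    origin. *)
Section local_cell.
Variables (T : eqType) (s : seq T) (P V : T -> space3 R) (i : T).
Hypothesis us : uniq s.
Hypothesis is_ : i \in s.
Hypothesis Pi : P i = 0.
Hypothesis Vi : V i = (0, 0, 1).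
Hypothesis V1 : forall j, j \in s -> dot3 (V j) (V j) = 1.
Hypothesis far : forall j k (a b : R), j \in s -> k \in s -> j != k ->
  0 <= a <= tau -> 0 <= b <= tau -> 4 <= sq3 (P j + a *: V j - (P k + b *: V k)).

(** 16 / 3 is the square of 2 rho. *)
Definition near_end (x : space3 R) : Prop :=
  exists2 j, j \in s & sq3 (x - P j) < 16 / 3 \/ sq3 (x - (P j + tau *: V j)) < 16 / 3.

Lemma axis_dist (y : R * R) (k : R) : 0 <= k <= tau ->
  seg_dist2 (P i) (V i) (y, k) = y.1 ^+ 2 + y.2 ^+ 2.
Proof.
move=> kt; rewrite /seg_dist2 /seg_point Pi Vi subr0.
have -> : dot3 (y, k) (0, 0, 1) = k by rewrite /dot3/=; ring.
by rewrite clamp_id// /sq3/dot3/= /GRing.scale/=; ring.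
Qed.

Lemma axis_dist_low (y : R * R) (k : R) : k <= 0 ->
  seg_dist2 (P i) (V i) (y, k) = y.1 ^+ 2 + y.2 ^+ 2 + k ^+ 2.
Proof.
move=> kt; rewrite /seg_dist2 /seg_point Pi Vi subr0.
have -> : dot3 (y, k) (0, 0, 1) = k by rewrite /dot3/=; ring.
by rewrite clamp_le0// /sq3/dot3/= /GRing.scale/=; ring.
Qed.

Lemma axis_dist_high (y : R * R) (k : R) : tau <= k ->
  seg_dist2 (P i) (V i) (y, k) = y.1 ^+ 2 + y.2 ^+ 2 + (k - tau) ^+ 2.
Proof.
move=> kt; rewrite /seg_dist2 /seg_point Pi Vi subr0.
have -> : dot3 (y, k) (0, 0, 1) = k by rewrite /dot3/=; ring.
by rewrite clamp_ge// /sq3/dot3/= /GRing.scale/=; ring.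
Qed.

(** Two axes are at distance at least 2. *)
Lemma unit_in_cell p : seg_dist2 (P i) (V i) p < 1 -> cell s P V i p.
Proof.
move=> d1; split; first by rewrite /=; lra.
move=> j js ji /=.
have := sq3_triangle p (seg_point (P j) (V j) p) (seg_point (P i) (V i) p).
have := far js is_ ji (clamp_range (dot3 (p - P j) (V j))) (clamp_range (dot3 (p - P i) (V i))).
rewrite -/(seg_point (P j) (V j) p) -/(seg_point (P i) (V i) p).
by move: d1; rewrite /seg_dist2; lra.
Qed.

(** The section at height h, when no end is near its center x. *)
Section qualified.
Variable h : R.
Hypothesis hr : 0 <= h <= tau.
Hypothesis no_end : ~ near_end (0, 0, h).
Let x : space3 R := (0, 0, h).

(** A line meets the ball in an interval.  If the segment meets the ball and has
    no end in it, the segment contains this interval. *)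
Lemma line_in_segment j a c : j \in s -> 0 <= a <= tau ->
  sq3 (x - (P j + a *: V j)) < 16 / 3 -> sq3 (x - (P j + c *: V j)) < 16 / 3 ->
  0 <= c <= tau.
Proof.
move=> js /andP[a0 at_] ha hc.
have e0 : 16 / 3 <= sq3 (x - P j).
  by rewrite leNgt; apply/negP => e; apply: no_end; exists j => //; left.
have e1 : 16 / 3 <= sq3 (x - (P j + tau *: V j)).
  by rewrite leNgt; apply/negP => e; apply: no_end; exists j => //; right.
(* the squared distance from x is a convex function on the line *)
have conv (a' c' k : R) : 0 <= k <= 1 -> sq3 (x - (P j + (k * a' + (1 - k) * c') *: V j)) <=
    k * sq3 (x - (P j + a' *: V j)) + (1 - k) * sq3 (x - (P j + c' *: V j)).
  move=> /andP[k0 k1]; rewrite -subr_ge0.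
  rewrite (_ : _ - _ = k * (1 - k) * (a' - c') ^+ 2 * dot3 (V j) (V j)); last first.
    by case: (x) (P j) (V j) => [[x1 x2] x3] [[p1 p2] p3] [[v1 v2] v3];
       rewrite /sq3/dot3/= /GRing.scale/=; ring.
  rewrite V1// mulr1; apply: mulr_ge0; last exact: sqr_ge0.
  by rewrite mulr_ge0// subr_ge0.
apply/andP; split; rewrite leNgt; apply/negP => c_out.
  have ac : 0 < a - c by lra.
  have k01 : 0 <= - c / (a - c) <= 1 by rewrite divr_ge0 ?ler_pdivrMr//=; lra.
  have := conv a c _ k01.
  have -> : - c / (a - c) * a + (1 - - c / (a - c)) * c = 0 by field; rewrite gt_eqF.
  rewrite scale0r addr0 => hk; have := le_lt_trans hk (convex_comb_lt k01 ha hc).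
  by rewrite ltNge e0.
have ac : 0 < c - a by lra.
have k01 : 0 <= (tau - a) / (c - a) <= 1 by rewrite divr_ge0 ?ler_pdivrMr//=; lra.
have := conv c a _ k01.
have -> : (tau - a) / (c - a) * c + (1 - (tau - a) / (c - a)) * a = tau by field; rewrite gt_eqF.
move=> hk; have := le_lt_trans hk (convex_comb_lt k01 hc ha).
by rewrite ltNge e1.
Qed.

(** The ends of segment i are outside the ball as well, so a point of the ball is
    at the height of some point of that segment. *)
Lemma segment_far_from_axis j a : j \in s -> j != i -> 0 <= a <= tau ->
  sq3 (x - (P j + a *: V j)) < 16 / 3 ->
  4 <= (P j + a *: V j).1.1 ^+ 2 + (P j + a *: V j).1.2 ^+ 2.
Proof.
move=> js ji ar ha.
set q := P j + a *: V j in ha *.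
have e0 : 16 / 3 <= h ^+ 2.
  rewrite leNgt; apply/negP => e; apply: no_end; exists i => //; left.
  by rewrite Pi subr0 sq3E expr0n !add0r.
have e1 : 16 / 3 <= (h - tau) ^+ 2.
  rewrite leNgt; apply/negP => e; apply: no_end; exists i => //; right.
  rewrite (_ : sq3 _ = (h - tau) ^+ 2)// Pi Vi /sq3/dot3/= /GRing.scale/=; ring.
have qE : sq3 (x - q) = q.1.1 ^+ 2 + q.1.2 ^+ 2 + (h - q.2) ^+ 2.
  by rewrite /sq3/dot3/=; ring.
have q2 : 0 <= q.2 <= tau.
  move: (sqr_ge0 q.1.1) (sqr_ge0 q.1.2) hr => s1 s2 /andP[h0 h1].
  by apply/andP; split; nra.
have := far js is_ ji ar q2; rewrite -/q Pi Vi.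
by rewrite (_ : sq3 _ = q.1.1 ^+ 2 + q.1.2 ^+ 2)// /sq3/dot3/= /GRing.scale/=; ring.
Qed.

(** The other segments that meet the ball of radius 2 rho around x.  Only these
    can come closer than x to a point of the disc of radius [rho]. *)
Definition close : seq T :=
  [seq j <- s | (j != i) && `[< exists2 a, 0 <= a <= tau & sq3 (x - (P j + a *: V j)) < 16 / 3 >]].

Definition foot_param j : R := dot3 (x - P j) (V j).
(** The vector from x to its foot on line j. *)
Definition foot_of j : space3 R := P j - x + foot_param j *: V j.

Lemma foot_orth j : j \in s -> dot3 (foot_of j) (V j) = 0.
Proof.
move=> js; rewrite /foot_of /foot_param.
transitivity (dot3 (P j - x) (V j) * (1 - dot3 (V j) (V j))); last by rewrite V1// subrr mulr0.
by case: (x) (P j) (V j) => [[x1 x2] x3] [[p1 p2] p3] [[v1 v2] v3];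
  rewrite /dot3/= /GRing.scale/=; ring.
Qed.

Lemma foot_line j k : foot_of j + k *: V j = P j + (foot_param j + k) *: V j - x.
Proof.
rewrite /foot_of; move: (foot_param j) => m.
case: (x) (P j) (V j) => [[x1 x2] x3] [[p1 p2] p3] [[v1 v2] v3].
by congr (_, _, _); rewrite /= /GRing.scale/=; ring.
Qed.

Lemma closeP j : reflect
  [/\ j \in s, j != i & exists2 a, 0 <= a <= tau & sq3 (x - (P j + a *: V j)) < 16 / 3]
  (j \in close).
Proof.
rewrite mem_filter -andbA; apply: (iffP and3P) => [[ji /asboolP ? js]|[js ji h']]; first by [].
by split => //; apply/asboolP.
Qed.

Lemma sq3N (p : space3 R) : sq3 (- p) = sq3 p.
Proof. by case: p => [[p1 p2] p3]; rewrite /sq3/dot3/=; ring. Qed.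

Lemma close_foot j k : j \in close -> sq3 (foot_of j + k *: V j) < 16 / 3 ->
  0 <= foot_param j + k <= tau /\ sq3 (x - (P j + (foot_param j + k) *: V j)) < 16 / 3.
Proof.
move=> /closeP[js ji [a ar ha]]; rewrite foot_line -sq3N opprB => hk.
by split => //; exact: line_in_segment js ar ha hk.
Qed.

Lemma qualified_slice : ((2 * Num.sqrt 3)%:E <= area R [set y | cell s P V i (y, h)])%E.
Proof.
have uc : uniq close by exact: filter_uniq.
have cv j : j \in close -> dot3 (V j) (V j) = 1 by move=> /closeP[js _ _]; exact: V1.
have cz j : j \in close -> dot3 (foot_of j) (V j) = 0.
  by move=> /closeP[js _ _]; exact: foot_orth.
have c_axis j k : j \in close -> sq3 (foot_of j + k *: V j) < 16 / 3 ->
    4 <= (foot_of j + k *: V j).1.1 ^+ 2 + (foot_of j + k *: V j).1.2 ^+ 2.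
  move=> jc /(close_foot jc)[kr kd]; have /closeP[js ji _] := jc.
  by rewrite foot_line /= !subr0; exact: (segment_far_from_axis js ji kr kd).
have c_lines j k a b : j \in close -> k \in close -> j != k ->
    sq3 (foot_of j + a *: V j) < 16 / 3 -> sq3 (foot_of k + b *: V k) < 16 / 3 ->
    4 <= sq3 (foot_of j + a *: V j - (foot_of k + b *: V k)).
  move=> jc kc jk /(close_foot jc)[ar _] /(close_foot kc)[br _].
  have [/closeP[js _ _] /closeP[ks _ _]] := (jc, kc).
  by rewrite !foot_line opprB addrA subrK; exact: far.
apply: le_trans (packing_slice uc cv cz c_axis c_lines) _.
have mS : measurable (disc rho `\` union_seq close (fun j => line_cutoff (foot_of j) (V j))).
  apply: measurableD; first exact: measurable_disc.
  by apply: measurable_union_seq => j _; exact: measurable_cutoff.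
apply: le_measure; rewrite ?inE//.
  exact: measurable_slice (measurable_cell _ _ _ _).
move=> y [/= yd yK]; rewrite /cell/=; have dy := axis_dist y hr.
rewrite /disc/= sqr_rho in yd.
split; first by rewrite dy.
move=> j js ji; rewrite dy ltNge; apply/negP => jd; apply: yK.
set c := clamp (dot3 ((y, h) - P j) (V j)).
have cr : 0 <= c <= tau by exact: clamp_range.
have dq : sq3 ((y, h) - (P j + c *: V j)) <= y.1 ^+ 2 + y.2 ^+ 2 by [].
have xq : sq3 (x - (P j + c *: V j)) < 16 / 3.
  have := sq3_triangle (y, h) x (P j + c *: V j).
  rewrite (_ : sq3 ((y, h) - x) = y.1 ^+ 2 + y.2 ^+ 2); last by rewrite /sq3/dot3/=; ring.
  lra.
have jc : j \in close by apply/closeP; split => //; exists c.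
exists j => //; split; first by rewrite /disc/= sqr_rho.
have := sq3_line_conic y (c - foot_param j) (V1 js) (foot_orth js).
rewrite foot_line (addrC _ (c - _)) subrK.
rewrite (_ : sq3 ((y, 0) - (P j + c *: V j - x)) = sq3 ((y, h) - (P j + c *: V j))); last first.
  by case: (P j) (V j) => [[p1 p2] p3] [[v1 v2] v3]; rewrite /sq3/dot3/=; ring.
move=> e; have := sqr_ge0 (c - foot_param j - (y.1 * (V j).1.1 + y.2 * (V j).1.2)).
rewrite /=; lra.
Qed.

End qualified.

Definition unqualified : set R := `]0, tau[ `&` [set h | near_end (0, 0, h)].

Lemma measurable_unqualified : measurable unqualified.
Proof.
apply: measurableI => //.
have -> : [set h | near_end (0, 0, h)] = union_seq s (fun j =>
    [set h : R | sq3 ((0, 0, h) - P j) < 16 / 3] `|`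
    [set h : R | sq3 ((0, 0, h) - (P j + tau *: V j)) < 16 / 3]) by [].
apply: measurable_union_seq => j _.
have mz (a : space3 R) : measurable [set h : R | sq3 ((0, 0, h) - a) < 16 / 3].
  apply: measurable_lt_set; last exact: measurable_cst.
  by rewrite /sq3/dot3/=; mfun.
exact: measurableU.
Qed.

Lemma unit_slice (h q : R) : 0 <= q ->
  (forall y : R * R, y.1 ^+ 2 + y.2 ^+ 2 < q -> seg_dist2 (P i) (V i) (y, h) < 1) ->
  ((pi * q)%:E <= area R [set y | cell s P V i (y, h)])%E.
Proof.
move=> q0 qh; rewrite -area_open_disc//; apply: le_measure; rewrite ?inE.
- by apply: measurable_lt_set; mfun.
- exact: measurable_slice (measurable_cell _ _ _ _).
- by move=> y /= /qh /unit_in_cell.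
Qed.

(** The slabs below, above and around the segment are disjoint, and so are the
    qualified and the unqualified heights of the middle slab. *)
Lemma cell_volume :
  ((4 / 3 * pi)%:E + (pi%:E * length R unqualified +
    (2 * Num.sqrt 3)%:E * length R (`]0%R, tau[ `\` unqualified)) <=
    volume R (cell s P V i))%E.
Proof.
have mU := measurable_unqualified.
have pi0 := @pi_gt0 R.
have mC := measurable_cell s P V i.
pose D (n : nat) : set R := match n with
  | 0%N => [set z | -1 <= z <= 0] | 1%N => [set z | tau <= z <= tau + 1]
  | 2%N => unqualified | _ => `]0, tau[ `\` unqualified end.
have mD n : measurable (D n).
  case: n => [|[|[|n]]] //=; last exact: measurableD.
  - have : measurable `[-1 : R, 0]%classic by [].
    by congr measurable; apply/seteqP; split => z /=; rewrite in_itv.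
  - have : measurable `[tau, tau + 1]%classic by [].
    by congr measurable; apply/seteqP; split => z /=; rewrite in_itv.
pose W n := volume R (cell s P V i `&` [set p | D n p.2]).
have total : (W 0%N + (W 1%N + (W 2%N + W 3%N)) <= volume R (cell s P V i))%E.
  have := @sum_measure_le _ _ _ (volume R) _ [:: 0%N; 1%N; 2%N; 3%N]
    (fun n => cell s P V i `&` [set p | D n p.2]) (cell s P V i) isT mC.
  rewrite unlock /= adde0; apply.
  - by move=> n _; apply: measurableI => //; exact: (measurable_preimage measurable_snd (mD n)).
  - move=> m n [y z] ms ns /eqP mn [_ /= Dm] [_ /= Dn]; apply: mn.
    pose index := if z <= 0 then 0%N else if tau <= z then 1%N
      else if `[< unqualified z >] then 2%N else 3%N.
    suff DE k : k \in [:: 0%N; 1%N; 2%N; 3%N] -> D k z -> k = index by rewrite (DE m)// -(DE n).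
    have inner : `]0, tau[%classic z -> (z <= 0) = false /\ (tau <= z) = false.
      by rewrite /= in_itv/= => /andP[z0 z1]; rewrite !leNgt z0 z1.
    rewrite /index !inE => /or4P[] /eqP-> /=.
    + by move=> /andP[_ ->].
    + by move=> /andP[tz _]; rewrite leNgt (lt_le_trans tau0 tz) tz.
    + by move=> zU; have [/inner[-> ->] _] := zU; rewrite (asboolT zU).
    + by move=> [/inner[-> ->] zU]; rewrite (asboolF zU).
  - by move=> n _ p [].
have low : ((2 / 3 * pi)%:E <= W 0%N)%E.
  have -> : 2 / 3 * pi = pi * (1 ^+ 2 * (0 - -1) -
    ((0 - 0) ^+ 3 - (-1 - 0) ^+ 3) / 3) :> R by field.
  apply: volume_ge_cap => //.
  - by move=> z /andP[? ?]; rewrite subr0; nra.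
  - move=> z /andP[z1 z0]; apply: unit_slice; first by rewrite subr0; nra.
    by move=> y; rewrite subr0 => yz; rewrite axis_dist_low//; lra.
have high : ((2 / 3 * pi)%:E <= W 1%N)%E.
  have -> : 2 / 3 * pi = pi * (1 ^+ 2 * (tau + 1 - tau) -
    ((tau + 1 - tau) ^+ 3 - (tau - tau) ^+ 3) / 3) :> R by field.
  apply: volume_ge_cap => //; first by lra.
  - by move=> z /andP[? ?]; nra.
  - move=> z /andP[z1 z0]; apply: unit_slice; first by nra.
    by move=> y yz; rewrite axis_dist_high//; lra.
have mid : (pi%:E * length R unqualified <= W 2%N)%E.
  apply: volume_ge_const => //; first exact: ltW.
  move=> z [/= + _]; rewrite in_itv/= => /andP[z0 z1].
  rewrite -[pi]mulr1; apply: unit_slice => // y yz.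
  by rewrite axis_dist// ?(ltW z0) ?(ltW z1).
have main : ((2 * Num.sqrt 3)%:E * length R (`]0%R, tau[ `\` unqualified) <=
    W 3%N)%E.
  apply: volume_ge_const => //; first exact: measurableD.
  move=> z [/= + zU]; rewrite in_itv/= => /andP[z0 z1].
  apply: qualified_slice; first by rewrite (ltW z0) (ltW z1).
  by move=> ne; apply: zU; split => //=; rewrite in_itv/= z0.
have -> : 4 / 3 * pi = 2 / 3 * pi + 2 / 3 * pi :> R by field.
apply: le_trans total; rewrite EFinD -(addeA (2 / 3 * pi)%:E).
exact: leeD low (leeD high (leeD mid main)).
Qed.

End local_cell.
End segments.


(** * Counting segments in a ball *)
Section euclid.
Context {R : realType}.
Implicit Types (p q : space3 R).

Lemma cauchy_schwarz3 p q : dot3 p q ^+ 2 <= sq3 p * sq3 q.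
Proof.
case: p q => [[p1 p2] p3] [[q1 q2] q3]; rewrite /sq3/dot3/= -subr_ge0.
rewrite (_ : _ - _ = (p1 * q2 - p2 * q1) ^+ 2 + (p1 * q3 - p3 * q1) ^+ 2 +
  (p2 * q3 - p3 * q2) ^+ 2).
  by rewrite !addr_ge0 ?sqr_ge0.
by ring.
Qed.

(** The triangle inequality, stated for squared norms. *)
Lemma minkowski3 p q (a b : R) : 0 <= a -> 0 <= b ->
  sq3 p <= a ^+ 2 -> sq3 q <= b ^+ 2 -> sq3 (p + q) <= (a + b) ^+ 2.
Proof.
move=> a0 b0 pa qb.
have : dot3 p q <= a * b.
  have [d0|d0] := leP (dot3 p q) 0; first by apply: le_trans d0 _; exact: mulr_ge0.
  rewrite -ler_sqr ?nnegrE ?mulr_ge0 ?(ltW d0)//.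
  by rewrite exprMn; apply: le_trans (cauchy_schwarz3 p q) _; apply: ler_pM; rewrite ?sq3_ge0.
have -> : sq3 (p + q) = sq3 p + sq3 q + 2 * dot3 p q.
  by case: p q {pa qb} => [[p1 p2] p3] [[q1 q2] q3]; rewrite /sq3/dot3/=; ring.
by rewrite sqrrD; lra.
Qed.

End euclid.

Section global.
Context {R : realType}.
Variable tau : R.
Hypothesis tau0 : 0 < tau.
Local Notation rho := (@rho R).

(** Invariance of cells under the isometry that maps c to the origin. *)
Section frame.
Variables (L : space3 R -> space3 R) (c : space3 R).
Hypothesis LB : forall p q, L (p - q) = L p - L q.
Hypothesis LZ : forall k p, L (k *: p) = k *: L p.
Hypothesis Ldot : forall p q, dot3 (L p) (L q) = dot3 p q.

Lemma frame_sub p q : L (p - c) - L (q - c) = L (p - q).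
Proof. by rewrite -LB opprB addrA subrK. Qed.

Lemma frame_point p P V (k : R) :
  L (p - c) - (L (P - c) + k *: L V) = L (p - (P + k *: V)).
Proof. by rewrite opprD addrA frame_sub -LZ -LB opprD addrA. Qed.

Lemma frame_seg_dist2 P V p :
  seg_dist2 tau (L (P - c)) (L V) (L (p - c)) = seg_dist2 tau P V p.
Proof.
by rewrite /seg_dist2 /seg_point frame_sub Ldot frame_point /sq3 Ldot.
Qed.

Lemma frame_cell (T : eqType) (s : seq T) (P V : T -> space3 R) i :
  (fun p => L (p - c)) @^-1` (cell tau s (fun j => L (P j - c)) (fun j => L (V j)) i) =
  cell tau s P V i.
Proof.
apply/seteqP; split => p [/= h1 h2]; rewrite ?frame_seg_dist2 in h1; split => /=;
  rewrite ?frame_seg_dist2//; move=> j js ji; have := h2 j js ji;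
  by rewrite /= !frame_seg_dist2.
Qed.

End frame.

Variables (T : eqType) (s : seq T) (a u : T -> space3 R).
Hypothesis us : uniq s.
Hypothesis u1 : forall j, j \in s -> dot3 (u j) (u j) = 1.
Hypothesis far : forall j k (x y : R), j \in s -> k \in s -> j != k ->
  0 <= x <= tau -> 0 <= y <= tau -> 4 <= sq3 (a j + x *: u j - (a k + y *: u k)).

(** The parameters of the points of axis i at distance less than 2 rho from e. *)
Definition near_point i e : set R :=
  `]0, tau[ `&` [set h | sq3 (a i + h *: u i - e) < 16 / 3].

Lemma measurable_near_point i e : measurable (near_point i e).
Proof.
apply: measurableI => //; apply: measurable_lt_set; last exact: measurable_cst.
by rewrite /sq3/dot3/=; mfun.
Qed.

Definition near_ends i : set R :=
  `]0, tau[ `&` [set h | near_end tau s a u (a i + h *: u i)].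

Lemma near_endsE i : near_ends i =
  union_seq s (fun j => near_point i (a j) `|` near_point i (a j + tau *: u j)).
Proof.
apply/seteqP; split => h.
  by move=> [hI [j js [h'|h']]]; exists j => //; [left|right].
by move=> [j js [[hI h']|[hI h']]]; split => //; exists j => //; [left|right].
Qed.

Lemma measurable_near_ends i : measurable (near_ends i).
Proof.
rewrite near_endsE; apply: measurable_union_seq => j _.
by apply: measurableU; exact: measurable_near_point.
Qed.

Lemma dirichlet_cell_volume i : i \in s ->
  ((4 / 3 * pi)%:E + (pi%:E * length R (near_ends i) +
    (2 * Num.sqrt 3)%:E * length R (`]0%R, tau[ `\` near_ends i)) <=
    volume R (cell tau s a u i))%E.
Proof.
move=> is_; have [L [pL LB LZ Ldot Lu]] := exists_frame (u1 is_).
rewrite -(frame_cell (a i) LB LZ Ldot).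
have [_ pg] := preserves_comp pL (volume_translate (- a i)).
have -> : (fun p => L (p - a i)) = L \o (fun p => p - a i) by [].
rewrite pg; last exact: measurable_cell.
have axisE h : L (a i + h *: u i - a i) = (0, 0, h).
  rewrite addrAC subrr add0r LZ Lu; congr (_, _, _); rewrite /= /GRing.scale/= ?mulr0//.
  by rewrite mulr1.
have nE : near_ends i = unqualified tau s (fun j => L (a j - a i)) (fun j => L (u j)).
  have sqE h e : sq3 ((0, 0, h) - L (e - a i)) = sq3 (a i + h *: u i - e).
    by rewrite -axisE (frame_sub (a i) LB) /sq3 Ldot.
  have sqE' h j : sq3 ((0, 0, h) - (L (a j - a i) + tau *: L (u j))) =
      sq3 (a i + h *: u i - (a j + tau *: u j)).
    by rewrite -axisE (frame_point (a i) LB LZ) /sq3 Ldot.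
  apply/seteqP; split => h [hI [j js h']]; split => //; exists j => //; move: h';
  by rewrite /= ?sqE ?sqE'.
rewrite nE; apply: cell_volume => //.
- by have := LB 0 0; rewrite !subrr.
- by move=> j js; rewrite Ldot u1.
- move=> j k x y js ks jk xr yr.
  have -> : L (a j - a i) + x *: L (u j) - (L (a k - a i) + y *: L (u k)) =
     L (a j + x *: u j - (a k + y *: u k)).
    rewrite -(frame_point (a i) LB LZ); congr (_ - _).
    have LN q : L (- q) = - L q by rewrite -scaleN1r LZ scaleN1r.
    have LD p q : L (p + q) = L p + L q by rewrite -{1}[q]opprK LB LN opprK.
    by rewrite (addrAC (a j)) (LD (a j - a i)) LZ.
  by rewrite /sq3 Ldot; exact: far.
Qed.

(** The unit tube around the part of axis i described by [near_point]. *)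
Definition tube i e : set (space3 R) :=
  [set p | seg_dist2 tau (a i) (u i) p < 1] `&` [set p | near_point i e (dot3 (p - a i) (u i))].

Lemma measurable_axis_coordinate i :
  measurable_fun setT (fun p : space3 R => dot3 (p - a i) (u i)).
Proof. by rewrite /dot3/=; mfun. Qed.

Lemma measurable_tube i e : measurable (tube i e).
Proof.
apply: measurableI.
  by apply: measurable_lt_set; [exact: measurable_seg_dist2|exact: measurable_cst].
exact: (measurable_preimage (measurable_axis_coordinate i) (measurable_near_point i e)).
Qed.

Lemma tube_volume i e : i \in s ->
  (pi%:E * length R (near_point i e) <= volume R (tube i e))%E.
Proof.
move=> is_; have [L [pL LB LZ Ldot Lu]] := exists_frame (u1 is_).
have [_ pg] := preserves_comp pL (volume_translate (- a i)).
pose B := [set q : space3 R | seg_dist2 tau 0 (0, 0, 1) q < 1].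
have mB : measurable B.
  by apply: measurable_lt_set; [exact: measurable_seg_dist2|exact: measurable_cst].
have mN := measurable_near_point i e.
have -> : tube i e = (L \o (fun p => p - a i)) @^-1` (B `&` [set q | near_point i e q.2]).
  have dE p : seg_dist2 tau (a i) (u i) p = seg_dist2 tau 0 (0, 0, 1) (L (p - a i)).
    have L0 : L 0 = 0 by have := LB 0 0; rewrite !subrr.
    by rewrite -(frame_seg_dist2 (a i) LB LZ Ldot) subrr Lu L0.
  have cE p : dot3 (p - a i) (u i) = (L (p - a i)).2.
    by rewrite -Ldot Lu /dot3/=; ring.
  by apply/seteqP; split => p; rewrite /tube/B/= dE cE.
rewrite pg; last by apply: measurableI => //; exact: (measurable_preimage measurable_snd mN).
apply: volume_ge_const => //; first exact: pi_ge0.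
move=> h [/= + _]; rewrite in_itv/= => /andP[h0 h1].
rewrite -[pi]mulr1 -area_open_disc//; apply: le_measure; rewrite ?inE.
- by apply: measurable_lt_set; mfun.
- exact: measurable_slice mB.
- move=> y /= y1.
  by rewrite /B/= (@axis_dist _ _ unit (fun=> 0) (fun=> (0, 0, 1)) tt)// (ltW h0) (ltW h1).
Qed.


Lemma tube_in_ball i e : tube i e `<=` [set p | sq3 (p - e) <= (1 + 2 * rho) ^+ 2].
Proof.
move=> p [/= d1 [+ ne]]; rewrite /= in_itv/= => /andP[k0 k1].
set k := dot3 _ _ in k0 k1 ne.
have kE : seg_point tau (a i) (u i) p = a i + k *: u i.
  by rewrite /seg_point -/k clamp_id// (ltW k0) (ltW k1).
rewrite (_ : p - e = (p - (a i + k *: u i)) + (a i + k *: u i - e)); last by rewrite addrA subrK.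
have r2 := @sqr_rho R.
apply: minkowski3 => //; first by rewrite mulr_ge0// ltW// rho_gt0.
- by rewrite expr1n -kE; exact: ltW.
- by rewrite exprMn r2; move: ne => /= /ltW; lra.
Qed.

Lemma tubes_disjoint i j e p : i \in s -> j \in s -> i != j ->
  tube i e p -> tube j e p -> False.
Proof.
move=> is_ js ij [di _] [dj _].
have ci : cell tau s a u i p by apply: unit_in_cell => // ? ? ? ?; exact: far.
have cj : cell tau s a u j p by apply: unit_in_cell => // ? ? ? ?; exact: far.
exact: cell_disjoint is_ js ij ci cj.
Qed.

Let t0 : R := 4 / 3 * (1 + 2 * rho) ^+ 3.

(** The tubes are disjoint, have cross-sections of area pi, and lie in a ball of
    radius 1 + 2 rho. *)
Lemma sum_near_point e : (\sum_(i <- s) length R (near_point i e) <= t0%:E)%E.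
Proof.
have pi0 := @pi_gt0 R.
rewrite -(@lee_pmul2l _ pi%:E)// ?lte_fin//.
rewrite ge0_sume_distrr; last by move=> i _; exact: measure_ge0.
rewrite -EFinM (_ : pi * t0 = 4 / 3 * pi * (1 + 2 * rho) ^+ 3); last by rewrite /t0; ring.
have r0 := @rho_gt0 R.
rewrite -(volume_ball_at e); last by lra.
apply: (@le_trans _ _ (\sum_(i <- s) volume R (tube i e))%E).
  by rewrite big_seq [leRHS]big_seq; apply: lee_sum => i; exact: tube_volume.
apply: sum_measure_le => //.
- exact: (measurable_preimage (volume_translate (- e)).1 (measurable_ball3 _)).
- by move=> j _; exact: measurable_tube.
- by move=> i j p is_ js ij; exact: tubes_disjoint is_ js ij.
- by move=> i _; exact: tube_in_ball.
Qed.

Lemma sum_near_ends :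
  (\sum_(i <- s) length R (near_ends i) <= ((size s)%:R * (2 * t0))%:E)%E.
Proof.
apply: (@le_trans _ _ (\sum_(i <- s) \sum_(j <- s)
    (length R (near_point i (a j)) + length R (near_point i (a j + tau *: u j)))))%E.
  apply: lee_sum => i _; rewrite near_endsE.
  apply: (le_trans (measure_union_seq_le (length R) _)).
    by move=> j _; apply: measurableU; exact: measurable_near_point.
  by apply: lee_sum => j _; apply: measureU2; exact: measurable_near_point.
rewrite exchange_big/=.
apply: (@le_trans _ _ (\sum_(j <- s) (2 * t0)%:E)%E).
  apply: lee_sum => j _; rewrite big_split/= mulr2n mulrDl mul1r EFinD.
  by apply: leeD; exact: sum_near_point.
by rewrite sumEFin big_const_seq count_predT iter_addr_0 (mulr_natl (2 * t0) (size s)).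
Qed.

(** Replacing 2 sqrt 3 by pi on the exceptional heights costs 2 sqrt 3 - pi, which
    is nonnegative, times their total length. *)
Lemma packing_count (r : R) : 0 <= r ->
  (forall i, i \in s -> cell tau s a u i `<=` [set p | sq3 p <= r ^+ 2]) ->
  (size s)%:R * (2 * Num.sqrt 3 * (tau - 2 * t0) + 2 * pi * t0 + 4 / 3 * pi) <=
    4 / 3 * pi * r ^+ 3.
Proof.
move=> r0 cr; have pi0 := @pi_gt0 R.
have k0 : 0 <= 2 * Num.sqrt 3 - pi :> R by rewrite subr_ge0 pi_le_2sqrt3.
have cells : (\sum_(i <- s) volume R (cell tau s a u i) <= (4 / 3 * pi * r ^+ 3)%:E)%E.
  rewrite -volume_ball//; apply: sum_measure_le => //.
  - exact: measurable_ball3.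
  - by move=> j _; exact: measurable_cell.
  - by move=> i j p; exact: cell_disjoint.
have each i : i \in s -> ((4 / 3 * pi + 2 * Num.sqrt 3 * tau)%:E <=
    volume R (cell tau s a u i) + (2 * Num.sqrt 3 - pi)%:E * length R (near_ends i))%E.
  move=> is_; have := dirichlet_cell_volume is_.
  have mN := measurable_near_ends i.
  have : (length R `]0%R, tau[%classic =
      length R (near_ends i) + length R (`]0%R, tau[ `\` near_ends i))%E.
    rewrite -measureU//; last 2 first.
    - exact: measurableD.
    - by rewrite setDE setICA setICr setI0.
    by rewrite setDUK// => z [].
  rewrite length_oo; last exact: ltW.
  have : (0 <= length R (near_ends i))%E by exact: measure_ge0.
  have : (0 <= length R (`]0%R, tau[ `\` near_ends i))%E by exact: measure_ge0.
  move: (length R (near_ends i)) (length R _) => [x| |] [y| |]//= _ _ [xy].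
  move: (volume R _) => [v| |]//=; rewrite -?EFinM -?EFinD ?lee_fin ?leey//.
  by move: (@pi R) => p; nra.
have : (\sum_(i <- s) (4 / 3 * pi + 2 * Num.sqrt 3 * tau)%:E <=
   (4 / 3 * pi * r ^+ 3)%:E + (2 * Num.sqrt 3 - pi)%:E * ((size s)%:R * (2 * t0))%:E)%E.
  apply: (@le_trans _ _ (\sum_(i <- s) (volume R (cell tau s a u i) +
     (2 * Num.sqrt 3 - pi)%:E * length R (near_ends i)))%E).
    by rewrite big_seq [leRHS]big_seq; apply: lee_sum => i; exact: each.
  rewrite big_split/=; apply: leeD => //.
  rewrite -ge0_sume_distrr; last by move=> i _; exact: measure_ge0.
  by apply: lee_wpmul2l; rewrite ?lee_fin//; exact: sum_near_ends.
rewrite sumEFin big_const_seq count_predT iter_addr_0 -EFinM -EFinD lee_fin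
  -(mulr_natl (4 / 3 * pi + 2 * Num.sqrt 3 * tau)).
by move: (@pi R) (size s)%:R => p n; lra.
Qed.

End global.


(** * Cylinders and their inner axes *)
Section cylinders.
Context {R : realType}.
Implicit Types (p q u : space3 R).
Local Notation rho := (@rho R).

Lemma norm3_le q (r : R) : 0 <= r -> (norm3 q <= r) = (sq3 q <= r ^+ 2).
Proof.
move=> r0; rewrite /norm3 -[X in _ <= X]ger0_norm// -sqrtr_sqr ler_sqrt ?sqr_ge0//.
Qed.

Lemma norm3_eq1 u : norm3 u = 1 -> dot3 u u = 1.
Proof. by move=> u1; rewrite -[LHS]sqr_sqrtr ?sq3_ge0// -/(norm3 u) u1 expr1n. Qed.

Lemma continuous_sq3B (c : space3 R) : continuous (fun q => sq3 (q - c)).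
Proof.
move=> q; rewrite /sq3/dot3/=.
have c11 : continuous (fun q : space3 R => q.1.1 - c.1.1).
  move=> x; apply: cvgB; last exact: cvg_cst.
  by apply: (@continuous_comp _ _ _ (fun q : space3 R => q.1) fst); exact: cvg_fst.
have c12 : continuous (fun q : space3 R => q.1.2 - c.1.2).
  move=> x; apply: cvgB; last exact: cvg_cst.
  by apply: (@continuous_comp _ _ _ (fun q : space3 R => q.1) snd); [exact: cvg_fst|exact: cvg_snd].
have c2 : continuous (fun q : space3 R => q.2 - c.2).
  by move=> x; apply: cvgB; [exact: cvg_snd|exact: cvg_cst].
apply: cvgD; last by apply: cvgM; exact: c2.
by apply: cvgD; apply: cvgM; [exact: c11|exact: c11|exact: c12|exact: c12].
Qed.

Lemma open_ball3 (c : space3 R) : open [set q | sq3 (q - c) < 1].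
Proof.
apply: (@open_comp _ _ (fun q => sq3 (q - c)) [set x | x < 1]).
  by move=> x _; exact: continuous_sq3B.
exact: open_lt.
Qed.

Lemma orthogonal_part (w u : space3 R) : dot3 u u = 1 ->
  dot3 (w - dot3 w u *: u) u = 0 /\ sq3 (w - dot3 w u *: u) = sq3 w - dot3 w u ^+ 2.
Proof.
move=> u1; split.
  transitivity (dot3 w u * (1 - dot3 u u)); last by rewrite u1 subrr mulr0.
  by case: w u {u1} => [[w1 w2] w3] [[v1 v2] v3]; rewrite /dot3/= /GRing.scale/=; ring.
transitivity (sq3 w - dot3 w u ^+ 2 - dot3 w u ^+ 2 * (1 - dot3 u u)).
  by case: w u {u1} => [[w1 w2] w3] [[v1 v2] v3]; rewrite /sq3/dot3/= /GRing.scale/=; ring.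
by rewrite u1 subrr mulr0 subr0.
Qed.

(** Points at distance less than 1 from the inner axis overshoot it by less than
    the unit length that was cut off. *)
Lemma ball_in_cylinder (t x : R) p u : norm3 u = 1 -> 0 <= x <= t - 2 ->
  [set q | sq3 (q - (p + u + x *: u)) < 1] `<=` cylinder3 t p u.
Proof.
move=> /norm3_eq1 u1 /andP[x0 xt] q /=; set w' := q - _ => w1.
pose k := dot3 w' u.
have k2 : k ^+ 2 < 1 by apply: le_lt_trans (cauchy_schwarz3 w' u) _; rewrite /sq3 u1 mulr1.
have kr : -1 <= k <= 1 by apply/andP; split; nra.
exists (1 + x + k), (w' - k *: u); split.
- by case/andP: kr => ? ?; apply/andP; split; lra.
- exact: (orthogonal_part w' u1).1.
- rewrite norm3_le// expr1n (orthogonal_part w' u1).2 -/k.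
  by have := sqr_ge0 k; lra.
- rewrite /w'; move: k {kr k2} => k.
  case: (q) (p) (u) => [[q1 q2] q3] [[p1 p2] p3] [[v1 v2] v3].
  by congr (_, _, _); rewrite /= /GRing.scale/=; ring.
Qed.

(** Otherwise the midpoint of the two axis points would be interior to both
    cylinders. *)
Lemma inner_axes_far (t x y : R) p u p' u' : norm3 u = 1 -> norm3 u' = 1 ->
  0 <= x <= t - 2 -> 0 <= y <= t - 2 ->
  (cylinder3 t p u)° `&` (cylinder3 t p' u')° = set0 ->
  4 <= sq3 (p + u + x *: u - (p' + u' + y *: u')).
Proof.
move=> u1 u1' xt yt dis; rewrite leNgt; apply/negP => lt4.
have inner v (z : R) c : norm3 v = 1 -> 0 <= z <= t - 2 ->
    [set q | sq3 (q - (c + v + z *: v)) < 1] `<=` (cylinder3 t c v)°.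
  by move=> v1 zt; rewrite -open_subsetE; [exact: ball_in_cylinder|exact: open_ball3].
set c := p + u + x *: u in lt4 *; set c' := p' + u' + y *: u' in lt4 *.
pose m := 2^-1 *: (c + c').
have mc : sq3 (m - c) < 1.
  rewrite (_ : sq3 (m - c) = sq3 (c - c') / 4); first by lra.
  rewrite /m; case: (c) (c') => [[a1 a2] a3] [[b1 b2] b3].
  by rewrite /sq3/dot3/= /GRing.scale/=; field.
have mc' : sq3 (m - c') < 1.
  rewrite (_ : sq3 (m - c') = sq3 (c - c') / 4); first by lra.
  rewrite /m; case: (c) (c') => [[a1 a2] a3] [[b1 b2] b3].
  by rewrite /sq3/dot3/= /GRing.scale/=; field.
suff : set0 m by [].
by rewrite -dis; split; [exact: inner xt _ mc|exact: inner yt _ mc'].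
Qed.

Lemma volume_cylinder (t : R) p u : 0 <= t -> norm3 u = 1 ->
  (volume R (cylinder3 t p u) <= (pi * t)%:E)%E.
Proof.
move=> t0 /norm3_eq1 u1; have [L [pL LB LZ Ldot Lu]] := exists_frame u1.
have [_ pg] := preserves_comp pL (volume_translate (- p)).
pose B := [set q : space3 R | 0 <= q.2] `&` [set q | q.2 <= t] `&`
  [set q | q.1.1 ^+ 2 + q.1.2 ^+ 2 <= 1].
have mB : measurable B.
  by apply: measurableI; [apply: measurableI|]; apply: measurable_le_set; mfun.
have hE q : (L q).2 = dot3 q u by rewrite -Ldot Lu /dot3/=; ring.
have sE q : sq3 q = (L q).1.1 ^+ 2 + (L q).1.2 ^+ 2 + (L q).2 ^+ 2.
  by rewrite /sq3 -Ldot /dot3; ring.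
have -> : cylinder3 t p u = (L \o (fun q => q - p)) @^-1` B.
  apply/seteqP; split => q.
    move=> [s [w [/andP[s0 st] wu w1 ->]]].
    rewrite norm3_le// expr1n in w1.
    have E : p + s *: u + w - p = s *: u + w by rewrite addrC addrA addrA addNr add0r.
    have hs : dot3 (s *: u + w) u = s.
      transitivity (s * dot3 u u + dot3 w u); last by rewrite u1 wu; ring.
      by case: (u) (w) => [[v1 v2] v3] [[w_1 w_2] w_3]; rewrite /dot3/= /GRing.scale/=; ring.
    rewrite /B/= E; have Es := sE (s *: u + w); rewrite hE hs in Es *.
    split; first by split.
    have : sq3 (s *: u + w) = sq3 w + s ^+ 2.
      transitivity (s ^+ 2 * dot3 u u + 2 * s * dot3 w u + sq3 w); last by rewrite u1 wu; ring.
      by case: (u) (w) => [[v1 v2] v3] [[w_1 w_2] w_3]; rewrite /sq3/dot3/= /GRing.scale/=; ring.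
    by lra.
  move=> [[/= h0 ht] r1]; set w' := q - p in h0 ht r1.
  rewrite hE in h0 ht; set k := dot3 w' u in h0 ht.
  exists k, (w' - k *: u); split.
  - by rewrite h0.
  - exact: (orthogonal_part w' u1).1.
  - by rewrite norm3_le// expr1n (orthogonal_part w' u1).2 sE hE -/k; lra.
  - rewrite /w'; move: (k) => k'.
    case: (q) (p) (u) => [[q1 q2] q3] [[p1 p2] p3] [[v1 v2] v3].
    by congr (_, _, _); rewrite /= /GRing.scale/=; ring.
rewrite pg//.
have -> : (pi * t)%:E = (\int[length R]_(h in `[0%R, t]) (cst pi%:E) h)%E.
  rewrite integral_cst//= lebesgue_measure_itv/= lte_fin.
  by case: ltgtP t0 => // [_ _|<- _]; rewrite ?oppr0 ?adde0 ?mule0 ?mulr0.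
apply: (@le_slices _ _ _ _ _ (area R) (length R) _ _ (cst pi)) => //.
- by move=> y h [[/= h0 ht] _]; rewrite in_itv/= h0.
- move=> h _; rewrite /cst -[pi]mulr1; apply: le_trans (area_closed_disc_le _) => //.
  apply: le_measure; rewrite ?inE.
  + exact: measurable_slice mB.
  + by apply: measurable_le_set; mfun.
  + by move=> y [_].
Qed.

End cylinders.


(** * The density bound *)
(** For r > 2 the cube is at most 1 + 14 / r. *)
Lemma limf_esup_pinfty_le (R : realType) (f : R -> \bar R) (c : R) : 0 <= c ->
  (forall r, 0 < r -> (f r <= (c * ((r + 2) / r) ^+ 3)%:E)%E) ->
  (limf_esup f +oo%R <= c%:E)%E.
Proof.
move=> c0 fc; apply/lee_addgt0Pr => e e0.
pose M : R := Num.max 2 (14 * c / e).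
have M2 : 2 <= M by rewrite le_max lexx.
have Mc : 14 * c / e <= M by rewrite le_max lexx orbT.
apply: (@le_trans _ _ (ereal_sup (f @` [set r | M < r]))).
  apply: ereal_inf_lbound; exists [set r | M < r] => //.
  by exists M; split => //; exact: num_real.
apply: ge_ereal_sup => _ [r /= Mr <-].
have r0 : 0 < r by lra.
apply: (le_trans (fc r r0)); rewrite -EFinD lee_fin.
have d0 : 0 < 2 / r by rewrite divr_gt0.
have d1 : 2 / r <= 1 by rewrite ler_pdivrMr// mul1r; lra.
have -> : (r + 2) / r = 1 + 2 / r by field; rewrite gt_eqF.
have cd : 7 * c * (2 / r) <= e.
  rewrite mulrA ler_pdivrMr//; move: Mc; rewrite ler_pdivrMr// => Mc.
  have : M * e <= r * e by rewrite ler_pM2r// ltW.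
  lra.
move: (2 / r) d0 d1 cd => d d0 d1 cd.
have d2 : d ^+ 2 <= d by rewrite expr2; nra.
have d3 : d ^+ 3 <= d by rewrite exprS; nra.
have : (1 + d) ^+ 3 <= 1 + 7 * d.
  by rewrite (_ : (1 + d) ^+ 3 = 1 + 3 * d + 3 * d ^+ 2 + d ^+ 3); [lra|ring].
move=> /(ler_wpM2l c0); lra.
Qed.

(** V0 is the lower bound for the average volume of a cell. *)
Section packing.
Variables (R : realType) (t : R) (I : countType) (Z : I -> set (space3 R)).
Local Notation rho := (@rho R).
Let t0 : R := 4 / 3 * (4 / Num.sqrt 3 + 1) ^+ 3.
Let V0 : R := 2 * Num.sqrt 3 * (t - 2 - 2 * t0) + 2 * pi * t0 + 4 / 3 * pi.

Lemma t0E : t0 = 4 / 3 * (1 + 2 * rho) ^+ 3.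
Proof. by rewrite /t0 rhoE addrC; congr (_ * (_ + _) ^+ 3); rewrite mulrA; congr (_ / _); ring. Qed.

Lemma t0_gt0 : 0 < t0.
Proof. by rewrite mulr_gt0// exprn_gt0// ltr_wpDl// divr_ge0// sqrtr_ge0. Qed.

Hypothesis t_large : 2 * t0 + 2 <= t.
Hypothesis packing : cylinder_packing t Z.

Lemma V0_gt0 : 0 < V0.
Proof.
have tt := t0_gt0; have pi0 := @pi_gt0 R.
have : 0 <= 2 * Num.sqrt 3 * (t - 2 - 2 * t0) :> R.
  by apply: mulr_ge0; [rewrite mulr_ge0 ?sqrtr_ge0|have := t_large; lra].
have : 0 < 2 * pi * t0 by rewrite !mulr_gt0.
by rewrite /V0; move: (@pi R) pi0 => p; lra.
Qed.

Lemma packing_count_ball (r : R) (s : seq I) : 0 <= r -> uniq s ->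
  (forall i, i \in s -> Z i `<=` cball3 r) ->
  (size s)%:R * V0 <= 4 / 3 * pi * (r + 2) ^+ 3.
Proof.
move=> r0 us sr; have [cylZ trivZ] := packing.
have [p /choice[u pu]] := choice cylZ.
pose tau := t - 2.
have tau0 : 0 < tau by have := t0_gt0; have := t_large; rewrite /tau; lra.
pose a i := p i + u i.
have u1 j : j \in s -> dot3 (u j) (u j) = 1 by move=> _; apply: norm3_eq1; have [] := pu j.
have far j k (x y : R) : j \in s -> k \in s -> j != k -> 0 <= x <= tau -> 0 <= y <= tau ->
    4 <= sq3 (a j + x *: u j - (a k + y *: u k)).
  move=> _ _ jk xt yt; have [[uj Zj] [uk Zk]] := (pu j, pu k).
  apply: (@inner_axes_far _ t) => //; rewrite -Zj -Zk; apply/eqP/negPn/negP => /set0P ne.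
  by move/eqP: jk; apply; exact: trivZ.
rewrite /V0 t0E; apply: (packing_count tau0 us u1 far); first lra.
move=> i is_ q [/= qi _].
set c := seg_point tau (a i) (u i) q in qi *.
have [ui Zi] := pu i.
have cZ : Z i c.
  rewrite Zi; pose k := clamp tau (dot3 (q - a i) (u i)).
  have /andP[k0 k1] : 0 <= k <= tau by exact: clamp_range.
  exists (1 + k), 0; split.
  - by apply/andP; split; rewrite /tau in k1; lra.
  - by rewrite /dot3/= !mul0r !addr0.
  - by rewrite norm3_le// /sq3 /dot3/= !mul0r !addr0 expr1n.
  - by rewrite /c /seg_point -/k /a scalerDl scale1r addr0 addrA.
have := sr i is_ c cZ; rewrite /cball3/= norm3_le// => cr.
rewrite -(subrK c q) (addrC r); apply: minkowski3 => //.
by move: qi; rewrite /seg_dist2 -/c; lra.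
Qed.

(** It is enough to bound finite sums, so that the number of cylinders in the
    ball need not be known to be finite beforehand. *)
Lemma density_bound (r : R) : 0 < r ->
  (\esum_(i in [set i | Z i `<=` cball3 r]) (vol3 (Z i) / vol3 (cball3 r)) <=
   (pi * t / V0 * ((r + 2) / r) ^+ 3)%:E)%E.
Proof.
move=> r0; have pi0 := @pi_gt0 R; have v0 := V0_gt0.
have tp : 0 < t by have := t0_gt0; have := t_large; lra.
pose b : R := 4 / 3 * pi * r ^+ 3.
have b0 : 0 < b by rewrite /b !mulr_gt0// exprn_gt0.
have vb : vol3 (cball3 r) = b%:E.
  rewrite -(volume_ball (ltW r0)); congr (volume R _).
  by apply/seteqP; split => q; rewrite /cball3/= norm3_le// ltW.
have vZ i : (vol3 (Z i) <= (pi * t)%:E)%E.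
  have [[p [u [u1 ->]]] _] := (packing.1 i, tt); exact: (volume_cylinder p (ltW tp) u1).
apply: ge_ereal_sup => _ [A [finA Ar] <-].
rewrite fsbig_finite//; set s := finmap.enum_fset (fset_set A).
have sr i : i \in s -> Z i `<=` cball3 r.
  move=> is_; have : i \in A by rewrite -(in_fset_set finA).
  by rewrite inE => /Ar.
have := packing_count_ball (ltW r0) (finmap.fset_uniq (fset_set A)) sr.
set n := size _ => hn.
apply: (@le_trans _ _ (\sum_(i <- s) (pi * t / b)%:E)%E).
  apply: lee_sum => i _; rewrite vb inver gt_eqF//= EFinM.
  by apply: lee_wpmul2r; [rewrite lee_fin invr_ge0 ltW|exact: vZ].
rewrite sumEFin big_const_seq count_predT iter_addr_0 lee_fin -/n.
rewrite -(mulr_natl (pi * t / b)).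
have -> : n%:R * (pi * t / b) = pi * t / (V0 * b) * (n%:R * V0).
  by move: (@pi R) => p; field; rewrite !gt_eqF.
have -> : pi * t / V0 * ((r + 2) / r) ^+ 3 = pi * t / (V0 * b) * (4 / 3 * pi * (r + 2) ^+ 3).
  by rewrite /b; move: V0 v0 (@pi R) pi0 => V v0 p p0; field; rewrite !gt_eqF.
by apply: ler_wpM2l hn; rewrite !mulr_ge0 ?invr_ge0 ?mulr_ge0// ltW.
Qed.

End packing.

Theorem corollary4 (R : realType) (t : R) (I : countType)
    (Z : I -> set (space3 R)) :
  let t0 : R := 4 / 3 * (4 / Num.sqrt 3 + 1) ^+ 3 in
  2 * t0 + 2 <= t ->
  cylinder_packing t Z ->
  (upper_density Z <=
    (t / (Num.sqrt 12 / pi * (t - 2 - 2 * t0) + 2 * t0 + 4 / 3))%:E)%E.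
Proof.
move=> t0 t_large packing.
have pi0 := @pi_gt0 R; have v0 := V0_gt0 t_large.
have tp : 0 < t by have := t0_gt0 R; rewrite -/t0; lra.
have s12 : Num.sqrt 12 = 2 * Num.sqrt 3 :> R.
  have -> : 12 = 2 ^+ 2 * 3 :> R by ring.
  by rewrite sqrtrM ?sqr_ge0// sqrtr_sqr ger0_norm.
have -> : t / (Num.sqrt 12 / pi * (t - 2 - 2 * t0) + 2 * t0 + 4 / 3) =
   pi * t / (2 * Num.sqrt 3 * (t - 2 - 2 * t0) + 2 * pi * t0 + 4 / 3 * pi).
  rewrite s12; rewrite -/t0 in v0; move: (@pi R) pi0 v0 => p p0 v0.
  have -> : 2 * Num.sqrt 3 / p * (t - 2 - 2 * t0) + 2 * t0 + 4 / 3 =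
    (2 * Num.sqrt 3 * (t - 2 - 2 * t0) + 2 * p * t0 + 4 / 3 * p) / p by field; rewrite gt_eqF.
  by rewrite invf_div mulrA (mulrC t).
apply: limf_esup_pinfty_le; last by move=> r r0; exact: density_bound.
by rewrite divr_ge0 ?mulr_ge0 ?ltW.
Qed.
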